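(* Let $P$ be the standard triadic Cantor distribution on $\mathbb R$. Let $n\in\mathbb N$ with $n\geq 3$, and let $\ell(n)$ be the unique natural number with $3^{\ell(n)}\leq n<3^{\ell(n)+1}$. Let $I\subseteq\{1,2,3\}^{\ell(n)}$ with $\mathrm{card}(I)=n-3^{\ell(n)}$ if $3^{\ell(n)}\leq n\leq 2\cdot 3^{\ell(n)}$, and $\mathrm{card}(I)=n-2\cdot 3^{\ell(n)}$ if $2\cdot 3^{\ell(n)}<n<3^{\ell(n)+1}$. Define $$\alpha_n(I)=\begin{cases}\{a(\omega):\omega\in\{1,2,3\}^{\ell(n)}\setminus I\}\cup\bigcup_{\omega\in I}S_\omega(\alpha_2) & \text{if } 3^{\ell(n)}\leq n\leq 2\cdot 3^{\ell(n)},\\[4pt] \bigcup_{\omega\in\{1,2,3\}^{\ell(n)}\setminus I}S_\omega(\alpha_2)\ \cup\ \bigcup_{\omega\in I}S_\omega(\alpha_3) & \text{if } 2\cdot 3^{\ell(n)}<n<3^{\ell(n)+1},\end{cases}$$ where $\alpha_2=\{a(1,21),\,a(22,23,3)\}$ and $\alpha_3=\{a(1),a(2),a(3)\}$. Then $\alpha_n(I)$ is an optimal set of $n$-means for $P$, with corresponding quantization error $V_n=V(P;\alpha_n(I))$, where $$V(P;\alpha_n(I))=\begin{cases}\dfrac1{75^{\ell(n)}}\Big((2\cdot 3^{\ell(n)}-n)V+(n-3^{\ell(n)})V(P;\alpha_2)\Big) & \text{if } 3^{\ell(n)}\leq n\leq 2\cdot 3^{\ell(n)},\\[8pt] \dfrac1{75^{\ell(n)}}\Big((3^{\ell(n)+1}-n)V(P;\alpha_2)+(n-2\cdot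 3^{\ell(n)})V(P;\alpha_3)\Big) & \text{if } 2\cdot 3^{\ell(n)}<n<3^{\ell(n)+1}.\end{cases}$$
   Context: For $j=1,2,3$ let $S_j:\mathbb R\to\mathbb R$, $S_j(x)=\frac15x+\frac25(j-1)$. The standard triadic Cantor distribution $P$ is the unique Borel probability measure on $\mathbb R$ with $P=\frac13\sum_{j=1}^3P\circ S_j^{-1}$; its support is the Cantor set $C$ satisfying $C=S_1(C)\cup S_2(C)\cup S_3(C)$. For a word $\sigma=\sigma_1\cdots\sigma_m\in\{1,2,3\}^m$ put $S_\sigma=S_{\sigma_1}\circ\cdots\circ S_{\sigma_m}$ and $J_\sigma=S_\sigma([0,1])$. Let $X$ be a random variable with distribution $P$, and let $V$ denote its variance. For words $\beta,\gamma,\dots,\delta$, $a(\beta,\gamma,\dots,\delta)$ denotes the conditional expectation $E(X\mid X\in J_\beta\cup J_\gamma\cup\cdots\cup J_\delta)$. For a finite nonempty set $\alpha\subset\mathbb R$ the distortion error is $V(P;\alpha)=\int\min_{a\in\alpha}(x-a)^2\,dP(x)$. The $n$th quantization error is $V_n=V_n(P)=\inf\{V(P;\alpha):\alpha\subset\mathbb R,\ 1\leq\mathrm{card}(\alpha)\leq n\}$. An optimal set of $n$-means is a set $\alpha$ with at most $n$ points for which this infimum is attained. *)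

(* Defs.v *)
From HB Require Import structures.
From mathcomp Require Import all_boot all_order all_algebra finmap.
From mathcomp Require Import all_classical all_reals all_analysis.

Set Implicit Arguments.
Unset Strict Implicit.
Unset Printing Implicit Defensive.

Import Order.TTheory GRing.Theory Num.Theory.
Import numFieldNormedType.Exports.

Local Open Scope classical_set_scope.
Local Open Scope ring_scope.

(* The letters 1, 2, 3 are the ordinals 0, 1, 2 : 'I_3, so that the translation
   part 2/5 * (j - 1) of S_j reads 2/5 * j. *)
Definition letter1 : 'I_3 := @Ordinal 3 0 isT.
Definition letter2 : 'I_3 := @Ordinal 3 1 isT.
Definition letter3 : 'I_3 := @Ordinal 3 2 isT.

Section Cantor.
Context {R : realType}.

Definition simil (j : 'I_3) (x : R) : R := 5^-1 * x + 2 / 5 * j%:R.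

Definition S_word (s : seq 'I_3) : R -> R := foldr (fun j f => simil j \o f) id s.

Definition J (s : seq 'I_3) : set R := S_word s @` `[0, 1].

Definition triadic_cantor (P : probability (measurableTypeR R) R) : Prop :=
  forall A : set (measurableTypeR R), measurable A ->
    P A = ((3^-1)%:E * \sum_(j < 3) P (simil j @^-1` A))%E.

Section Quantization.
Variable P : probability (measurableTypeR R) R.
Local Open Scope ereal_scope.

Definition distortion (alpha : {fset R}) : \bar R :=
  \int[P]_x \big[Order.min/+oo]_(a <- alpha) ((x - a) ^+ 2)%:E.

Definition quantization_error (n : nat) : \bar R :=
  ereal_inf [set distortion alpha |
             alpha in [set alpha : {fset R} | (1 <= #|` alpha | <= n)%N]].

Definition optimal_means (n : nat) (alpha : {fset R}) : Prop :=
  (1 <= #|` alpha | <= n)%N /\ distortion alpha = quantization_error n.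

End Quantization.

Section ConditionalMeans.
Context {d : measure_display} {T : measurableType d}.
Variables (Q : probability T R) (X : T -> R).

(* The elementary conditional expectation E(X | X \in B), for an event of
   positive probability. *)
Definition cond_mean (B : set R) : R :=
  fine (\int[Q]_(t in X @^-1` B) (X t)%:E) / fine (Q (X @^-1` B)).

Definition cond_mean_words (words : seq (seq 'I_3)) : R :=
  cond_mean (\big[setU/set0]_(s <- words) J s).

Definition alpha2 : {fset R} :=
  [fset cond_mean_words [:: [:: letter1]; [:: letter2; letter1]];
        cond_mean_words
          [:: [:: letter2; letter2]; [:: letter2; letter3]; [:: letter3]]]%fset.

Definition alpha3 : {fset R} :=
  [fset cond_mean_words [:: [:: letter1]]; cond_mean_words [:: [:: letter2]];
        cond_mean_words [:: [:: letter3]]]%fset.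

(* The case split is only meaningful for 3 ^ l <= n < 3 ^ l.+1. *)
Definition alpha_n (n l : nat) (I : {set l.-tuple 'I_3}) : {fset R} :=
  (if (n <= 2 * 3 ^ l)%N then
     [fset cond_mean_words [:: val w] | w in ~: I] `|`
     \bigcup_(w in I) [fset S_word w x | x in alpha2]
   else
     \bigcup_(w in ~: I) [fset S_word w x | x in alpha2] `|`
     \bigcup_(w in I) [fset S_word w x | x in alpha3])%fset.

End ConditionalMeans.
End Cantor.

(* Main.v *)
Require Import Defs.
From HB Require Import structures.
From mathcomp Require Import all_boot all_order all_algebra finmap.
From mathcomp Require Import all_classical all_reals all_analysis.
From mathcomp Require Import measurable_realfun ring lra.

Set Implicit Arguments.
Unset Strict Implicit.
Unset Printing Implicit Defensive.

Import Order.TTheory GRing.Theory Num.Theory.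
Import numFieldNormedType.Exports.

Local Open Scope classical_set_scope.
Local Open Scope ring_scope.

(** Write V(s) for the distortion of a finite set s of centres.  Since P is the
    average of its three images, V(s) = (V(s_0) + V(s_1) + V(s_2)) / 75, where
    s_j = 5 s - 2 j is s in the coordinates of the jth third.  This relation
    gives both halves of the theorem.

    Upper bound.  Iterating it over words, a union of images of sets beta_w
    under the maps S_w, w of length l, costs at most the sum of the V(beta_w)
    divided by 75^l ([qerr_words_le]); the sets alpha_n(I) are such unions, with
    each beta_w optimal for 1, 2 or 3 points.

    Lower bound.  Between 3^l and 2 * 3^l, and between 2 * 3^l and 3^(l+1), the
    claimed value of V_n is affine in n, hence is the value at n of a line.  It
    turns out that each of these lines bounds V(s) from below at the cardinal of
    every finite set s ([lower_bound_A], [lower_bound_B]).  Lines are better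
    suited to induction than V_n itself: the line of level l+1 at n is 1/75 of
    the sum of the lines of level l at n_0, n_1, n_2, for every splitting
    n = n_0 + n_1 + n_2.

    The obstacle is that a centre lying in one third may also serve points of a
    neighbouring third.  Cut the line at the middles 3/10 and 7/10 of the gaps,
    and let each third own the centres on its side of the cuts.  In the
    coordinates of a third, its own centres lie in [-1/2, 3/2] and the others
    outside.  If a third owns a centre on each side of 1/2, the foreign centres
    are useless to it and induction applies; otherwise a whole end of that third
    is at distance at least 3/10 from all centres, which already costs
    (1/225 + 4/25) / 3, more than most lines require ([qerr_owns]).

    The one line for which this is not enough is the step from 1-2 points to
    3-6 points.  There, a third owning a single centre may really gain from a
    foreign one, but by at most [deficit], and only if the foreign centre is
    within 8/5 of the far end of the third ([qerr_deficit]).  Such a centre is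
    badly placed in the third that owns it, which loses at least [deficit] for
    every neighbour that it helps ([qerr_owner_left], [qerr_owner_both]), so the
    total balances ([line_first_step_unit]).

    The induction starts from two centres.  With t the midpoint of the two
    centres and h half their distance, the squared distance of x to the nearer
    one is (|x - t| - h)^2, so the best h is E|X - t|, and the claim becomes a
    bound for the convex function t |-> E|X - t|.  Its values at the ends of the
    gaps follow from self-similarity, and six chords stay below the required
    hyperbola ([absdev_sqr]), which one of them touches at the optimal
    midpoint 117/250. *)

(** * The measure is carried by the unit interval *)

Section Support.
Variables (R : realType) (P : probability (measurableTypeR R) R).
Hypothesis hP : triadic_cantor P.

Definition unitI : set (measurableTypeR R) := `[0, 1]%classic.

Lemma measurable_unitI : measurable unitI.
Proof. exact: measurable_itv. Qed.

Lemma unitIE (x : R) : unitI x <-> 0 <= x <= 1.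
Proof. by rewrite /unitI /= in_itv /=. Qed.

Lemma measurable_simil j :
  measurable_fun setT (simil j : measurableTypeR R -> measurableTypeR R).
Proof.
apply: measurable_funD; last exact: measurable_cst.
by apply: measurable_funM; [exact: measurable_cst|exact: measurable_id].
Qed.

Lemma simil_unitI j (x : R) : 0 <= x <= 1 -> 0 <= simil j x <= 1.
Proof.
rewrite /simil; case: j => -[|[|[|//]]] /= ? ; lra.
Qed.

Let outside (M : R) : set (measurableTypeR R) := ~` `[- M, 1 + M]%classic.

Let moutside M : measurable (outside M).
Proof. by apply: measurableC; exact: measurable_itv. Qed.

Let outside_simil M j : simil j @^-1` outside M `<=` outside (5 * M).
Proof.
move=> x /= h; apply: contra_not h; rewrite /= !in_itv /= /simil.
case: j => -[|[|[|//]]] /= ? ?; lra.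
Qed.

(** The preimage of the outside of [-M, 1 + M] under a map of ratio 1/5 from
    [0, 1] to itself lies outside [-5M, 1 + 5M], so the mass outside cannot
    decrease when M is multiplied by 5.  It tends to 0 at infinity, hence vanishes for M > 0. *)
Let outside_le M : (P (outside M) <= P (outside (5 * M)))%E.
Proof.
rewrite hP // !big_ord_recl big_ord0 adde0.
have h j : (P (simil j @^-1` outside M) <= P (outside (5 * M)))%E.
  apply: le_measure; rewrite ?inE //.
  by rewrite -[X in measurable X]setTI; apply: measurable_simil.
set u := P (outside (5 * M)).
have uf : u \is a fin_num by exact: fin_num_measure.
apply: (@le_trans _ _ ((3^-1)%:E * (u + (u + u)))%E).
  rewrite lee_pmul2l ?lte_fin // ?invr_gt0 //.
  by apply: leeD; [|apply: leeD]; exact: h.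
rewrite -(fineK uf) -!EFinD -EFinM lee_fin; lra.
Qed.

Lemma null_compl_unitI : P (~` unitI) = 0%E.
Proof.
have cover : \bigcap_(n : nat) outside (n%:R) = set0 :> set (measurableTypeR R).
  apply/seteqP; split => // x /=.
  have [n hn] : exists n : nat, `|x| <= n%:R.
    by exists (Num.truncn `|x|).+1; apply/ltW; exact: truncnS_gt.
  move=> /(_ n I); apply => /=; rewrite in_itv /=.
  by move: hn; rewrite ler_norml => /andP[? ?]; apply/andP; split; lra.
have dec : nonincreasing_seq (fun n : nat => outside n%:R).
  move=> m n mn; apply/subsetPset => x /= h; apply: contra_not h.
  rewrite /= !in_itv /=; have : m%:R <= n%:R :> R by rewrite ler_nat.
  lra.
have cvg0 : P (outside n%:R) @[n --> \oo] --> 0%E.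
  rewrite -[X in _ --> X](measure0 P) -cover.
  apply: nonincreasing_cvg_mu => //.
  - by apply: (le_lt_trans (probability_le1 _ _)) => //; rewrite ltry.
  - by apply: bigcapT_measurable => n.
have null M : 0 < M -> P (outside M) = 0%E.
  move=> M0; apply/eqP; rewrite eq_le measure_ge0 andbT.
  have le5 k : (P (outside M) <= P (outside (5 ^+ k * M)))%E.
    elim: k => [|k IH]; first by rewrite expr0 mul1r.
    by apply: (le_trans IH); rewrite exprS -mulrA; exact: outside_le.
  have len n : (P (outside M) <= P (outside n%:R))%E.
    pose k := (Num.truncn (n%:R / M)).+1.
    apply: (le_trans (le5 k)); apply: le_measure; rewrite ?inE //.
    have nk : n%:R <= 5 ^+ k * M :> R.
      rewrite -ler_pdivrMr //; apply: (@le_trans _ _ k%:R).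
        by apply/ltW; exact: truncnS_gt.
      by rewrite -natrX ler_nat ltnW // ltn_expl.
    move=> x /= h; apply: contra_not h; rewrite /= !in_itv /=; lra.
  rewrite -(cvg_lim _ cvg0) //; apply: lime_ge.
    by apply/cvg_ex; eexists; exact: cvg0.
  by apply: nearW.
have neg : P.-negligible (\bigcup_(n : nat) outside (n.+1%:R^-1)).
  apply: negligible_bigcup => n; apply/negligibleP => //.
  by apply: null; rewrite invr_gt0 ltr0n.
have -> : ~` unitI = \bigcup_(n : nat) outside (n.+1%:R^-1).
  apply/seteqP; split => x /=; last first.
    move=> [n _] /= h; apply: contra_not h; rewrite /unitI /= !in_itv /=.
    have : 0 <= n.+1%:R^-1 :> R by rewrite invr_ge0 ler0n.
    move: (_^-1) => e; lra.
  rewrite /unitI /= in_itv /= => /negP h.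
  have [e e0 he] : exists2 e : R, 0 < e & x <= - e \/ 1 + e <= x.
    move: h; rewrite negb_and -!ltNge => /orP[h|h].
      by exists (- x); [lra|left; lra].
    by exists (x - 1); [lra|right; lra].
  exists (Num.truncn e^-1) => //; rewrite /outside /= in_itv /=.
  have : (Num.truncn e^-1).+1%:R^-1 < e.
    rewrite -[X in _ < X]invrK ltf_pV2 ?posrE ?invr_gt0 ?ltr0n //.
    exact: truncnS_gt.
  move: (_.+1%:R^-1) => d ?; apply/negP; rewrite negb_and -!ltNge; apply/orP.
  by case: he => ?; [left|right]; lra.
by apply/negligibleP => //; apply: bigcup_measurable.
Qed.
End Support.
Arguments unitI : clear implicits.

(** * Means of bounded functions and self-similarity *)

HB.instance Definition _ (R : realType) (j : 'I_3) :=
  isMeasurableFun.Build _ _ _ _ (simil j : measurableTypeR R -> measurableTypeR R)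
    (measurable_simil j).

Section Mean.
Variable R : realType.
Implicit Types (P : probability (measurableTypeR R) R) (f g : R -> R).

(** Integrating over [0, 1] only, which carries all the mass, makes continuous
    functions bounded and hence integrable. *)
Definition mean P f : R := \int[P]_(x in unitI R) f x.

(** A class of integrable functions closed under sums, products, minima and
    composition with the similarities. *)
Definition nice f : Prop :=
  measurable_fun setT (f : measurableTypeR R -> measurableTypeR R) /\
  exists M, forall x, 0 <= x <= 1 -> `|f x| <= M.

Lemma nice_cst c : nice (fun=> c).
Proof. by split; [exact: measurable_cst|exists `|c|]. Qed.

Lemma nice_id : nice id.
Proof.
split; first exact: measurable_id.
by exists 1 => x /andP[? ?]; rewrite ger0_norm.
Qed.

Lemma niceD f g : nice f -> nice g -> nice (fun x => f x + g x).
Proof.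
move=> [mf [M hf]] [mg [N hg]]; split; first exact: measurable_funD.
exists (M + N) => x hx; apply: (le_trans (ler_normD _ _)).
by apply: lerD; [exact: hf|exact: hg].
Qed.

Lemma niceM f g : nice f -> nice g -> nice (fun x => f x * g x).
Proof.
move=> [mf [M hf]] [mg [N hg]]; split; first exact: measurable_funM.
by exists (M * N) => x hx; rewrite normrM ler_pM ?hf ?hg.
Qed.

Lemma niceX f n : nice f -> nice (fun x => f x ^+ n).
Proof.
move=> [mf [M hf]]; split; first exact: measurable_funX.
by exists (M ^+ n) => x hx; rewrite normrX lerXn2r ?nnegrE ?hf // (le_trans _ (hf x hx)).
Qed.

Lemma nice_min f g : nice f -> nice g -> nice (fun x => Num.min (f x) (g x)).
Proof.
move=> [mf [M hf]] [mg [N hg]]; split; first exact: measurable_minr.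
exists (M + N) => x hx; have := hf x hx; have := hg x hx.
have := normr_ge0 (f x); have := normr_ge0 (g x).
by rewrite minEle; case: ifP => _; lra.
Qed.

Lemma nice_norm f : nice f -> nice (fun x => `|f x|).
Proof.
move=> [mf [M hf]]; split; first exact: measurableT_comp.
by exists M => x hx; rewrite normr_id hf.
Qed.

Lemma nice_simil j f : nice f -> nice (fun x => f (simil j x)).
Proof.
move=> [mf [M hf]]; split.
  exact: (measurableT_comp mf (measurable_simil j)).
by exists M => x hx; apply: hf; exact: simil_unitI.
Qed.

Lemma nice_reflect f : nice f -> nice (fun x => f (1 - x)).
Proof.
move=> [mf [M hf]]; split.
  apply: (measurableT_comp mf); apply: measurable_funB; first exact: measurable_cst.
  exact: measurable_id.
by exists M => x hx; apply: hf; lra.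
Qed.

Lemma nice_integrable P f : nice f -> P.-integrable (unitI R) (EFin \o f).
Proof.
move=> [mf [M hf]]; apply: measurable_bounded_integrable.
- exact: measurable_unitI.
- rewrite ltey_eq fin_num_measure //; exact: measurable_unitI.
- exact: measurable_funTS.
- exists M; split; first by rewrite num_real.
  move=> N MN x /= /unitIE hx; exact: (le_trans (hf x hx) (ltW MN)).
Qed.

Lemma mean_le P f g : nice f -> nice g ->
  (forall x, 0 <= x <= 1 -> f x <= g x) -> mean P f <= mean P g.
Proof.
move=> nf ng fg; apply: le_Rintegral.
- exact: measurable_unitI.
- exact: nice_integrable.
- exact: nice_integrable.
- by move=> x /unitIE; exact: fg.
Qed.

Lemma eq_mean P f g : (forall x, 0 <= x <= 1 -> f x = g x) -> mean P f = mean P g.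
Proof.
by move=> fg; apply: eq_Rintegral => x; rewrite inE => /unitIE; exact: fg.
Qed.

Lemma meanD P f g : nice f -> nice g ->
  mean P (fun x => f x + g x) = mean P f + mean P g.
Proof.
by move=> nf ng; apply: RintegralD; [exact: measurable_unitI|
  exact: nice_integrable|exact: nice_integrable].
Qed.

Lemma meanZ P c f : nice f -> mean P (fun x => c * f x) = c * mean P f.
Proof.
by move=> nf; apply: RintegralZl; [exact: measurable_unitI|exact: nice_integrable].
Qed.

End Mean.
#[global] Hint Resolve nice_cst nice_id niceD niceM niceX : core.

Section SelfSimilar.
Variables (R : realType) (P : probability (measurableTypeR R) R).
Hypothesis hP : triadic_cantor P.
Implicit Types f g : R -> R.

Lemma ge0_integral_unitI (f : measurableTypeR R -> \bar R) :
  measurable_fun setT f -> (forall x, (0 <= f x)%E) ->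
  (\int[P]_x f x = \int[P]_(x in unitI R) f x)%E.
Proof.
move=> mf f0; rewrite (ge0_negligible_integral (N := ~` (unitI R))) //.
- by rewrite setTD setCK.
- by apply: measurableC; exact: measurable_unitI.
- exact: null_compl_unitI.
Qed.

Lemma ge0_integral_self_similar (f : measurableTypeR R -> \bar R) :
  measurable_fun setT f -> (forall x, (0 <= f x)%E) ->
  (\int[P]_x f x = (3^-1)%:E * \sum_(j < 3) \int[P]_x f (simil j x))%E.
Proof.
move=> mf f0.
pose m_ (n : nat) : {measure set (measurableTypeR R) -> \bar R} :=
  distribution P (simil (inord n : 'I_3) : {mfun measurableTypeR R >-> measurableTypeR R}).
have third_ge0 : 0 <= 3^-1 :> R by rewrite invr_ge0.
pose third : {nonneg R} := NngNum third_ge0.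
transitivity (\int[mscale third (msum m_ 3)]_x f x)%E.
  apply: eq_measure_integral => A mA _; apply: (eq_trans (hP mA)).
  rewrite /mscale /msum /=; congr (_ * _)%E; apply: eq_bigr => j _.
  by rewrite /m_ /distribution /pushforward inord_val.
rewrite ge0_integral_mscale //; congr (_ * _)%E.
rewrite ge0_integral_measure_sum //; apply: eq_bigr => j _.
by rewrite /m_ /distribution ge0_integral_pushforward // inord_val preimage_setT.
Qed.

Lemma mean1 : mean P (fun=> 1) = 1.
Proof.
have unit1 : P (unitI R) = 1%E.
  rewrite -[unitI R]setCK probability_setC ?null_compl_unitI ?sube0 //.
  by apply: measurableC; exact: measurable_unitI.
rewrite /mean Rintegral_cst; last exact: measurable_unitI.
by rewrite mul1r [X in fine X]unit1.
Qed.

Lemma mean_cst c : mean P (fun=> c) = c.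
Proof.
have -> : mean P (fun=> c) = mean P (fun x => c * 1) by apply: eq_mean => x _; rewrite mulr1.
by rewrite meanZ // mean1 mulr1.
Qed.

Lemma ge0_meanE f : nice f -> (forall x, 0 <= f x) ->
  (\int[P]_x (f x)%:E = (mean P f)%:E)%E.
Proof.
move=> nf f0; rewrite ge0_integral_unitI.
- rewrite /mean /Rintegral fineK //.
  by apply: integrable_fin_num; [exact: measurable_unitI|exact: nice_integrable].
- by apply/measurable_EFinP; case: nf.
- by move=> x; rewrite lee_fin.
Qed.

(** The ereal version needs a nonnegative integrand, hence the shift by a bound
    of f on the unit interval. *)
Lemma mean_self_similar f : nice f ->
  mean P f = 3^-1 * \sum_(j < 3) mean P (fun x => f (simil j x)).
Proof.
move=> nf; have [mf [M hM]] := nf.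
(* The absolute value makes g nonnegative outside [0, 1] too. *)
pose g x := `|f x + M|.
have ng : nice g by apply/nice_norm/niceD.
have gE x : 0 <= x <= 1 -> g x = f x + M.
  by move=> hx; rewrite /g ger0_norm //; have := hM x hx; rewrite ler_norml; lra.
have mgE : mean P g = mean P f + M.
  by rewrite (eq_mean P gE) meanD // mean_cst.
have mgjE j : mean P (fun x => g (simil j x)) = mean P (fun x => f (simil j x)) + M.
  rewrite -[X in _ + X]mean_cst -meanD //; last exact: nice_simil.
  by apply: eq_mean => x hx; rewrite gE //; exact: simil_unitI.
have : ((mean P g)%:E =
        (3^-1 * \sum_(j < 3) mean P (fun x => g (simil j x)))%:E)%E.
  have g0 x : 0 <= g x by exact: normr_ge0.
  have := @ge0_integral_self_similar (EFin \o g).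
  rewrite (ge0_meanE ng g0) => ->; last 2 first.
  - by apply/measurable_EFinP; case: ng.
  - by move=> x; rewrite lee_fin.
  rewrite EFinM -sumEFin; congr (_ * _)%E; apply: eq_bigr => j _.
  by rewrite /= (ge0_meanE (nice_simil j ng)).
move=> [] ; rewrite mgE (eq_bigr _ (fun j _ => mgjE j)) !big_ord_recl !big_ord0.
lra.
Qed.

End SelfSimilar.

Section Moments.
Variables (R : realType) (P : probability (measurableTypeR R) R).
Hypothesis hP : triadic_cantor P.
Implicit Types f g : R -> R.

Lemma mean_thirds f : nice f ->
  mean P f = (mean P (fun x => f (x / 5)) + mean P (fun x => f (x / 5 + 2 / 5)) +
              mean P (fun x => f (x / 5 + 4 / 5))) / 3.
Proof.
move=> nf; rewrite (mean_self_similar hP nf) !big_ord_recl big_ord0 addr0 mulrC addrA.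
congr ((_ + _ + _) / _); apply: eq_mean => x _; congr f; rewrite /simil /= /bump /=; lra.
Qed.

Let mean_affine u v : mean P (fun x => u * x + v) = u * mean P id + v.
Proof. by rewrite meanD ?meanZ ?mean_cst //; exact: niceM. Qed.

Lemma mean_id : mean P id = 2^-1.
Proof.
have := mean_thirds (@nice_id R).
have E c : mean P (fun x => x / 5 + c) = 5^-1 * mean P id + c.
  by rewrite -mean_affine; apply: eq_mean => x _; rewrite mulrC.
have := E 0; rewrite (@eq_mean _ _ _ (fun x => x / 5)); last by move=> x _; rewrite addr0.
rewrite /= !E => ->; lra.
Qed.

Lemma mean_line u v : mean P (fun x => u * x + v) = u / 2 + v.
Proof. by rewrite mean_affine mean_id. Qed.

Let mean_quadratic u v w :
  mean P (fun x => u * x ^+ 2 + (v * x + w)) =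
  u * mean P (fun x => x ^+ 2) + (v / 2 + w).
Proof.
rewrite meanD ?mean_affine ?mean_id ?meanZ //.
- exact: niceX.
- by apply: niceM => //; exact: niceX.
- by apply: niceD => //; exact: niceM.
Qed.

Let mean_sqr : mean P (fun x => x ^+ 2) = 13 / 36.
Proof.
have := mean_thirds (niceX 2 (@nice_id R)).
have E c : mean P (fun x => (x / 5 + c) ^+ 2) =
    25^-1 * mean P (fun x => x ^+ 2) + (2 / 5 * c / 2 + c ^+ 2).
  by rewrite -mean_quadratic; apply: eq_mean => x _; field.
have := E 0; rewrite (@eq_mean _ _ _ (fun x => (x / 5) ^+ 2)); last by move=> x _; rewrite addr0.
rewrite /= !E => ->; lra.
Qed.

(** The mean of P is 1/2 and its variance 1/9. *)
Lemma mean_sqr_affine u v : mean P (fun x => (u * x + v) ^+ 2) = u ^+ 2 / 9 + (u / 2 + v) ^+ 2.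
Proof.
transitivity (mean P (fun x => u ^+ 2 * x ^+ 2 + ((2 * u * v) * x + v ^+ 2))).
  by apply: eq_mean => x _; ring.
by rewrite mean_quadratic mean_sqr; field.
Qed.

Lemma mean_sqr_dist a : mean P (fun x => (x - a) ^+ 2) = 9^-1 + (a - 2^-1) ^+ 2.
Proof.
transitivity (mean P (fun x => (1 * x + - a) ^+ 2)).
  by apply: eq_mean => x _; rewrite mul1r.
by rewrite mean_sqr_affine; field.
Qed.

End Moments.

Section Reflection.
Variable R : realType.
Implicit Types (P : probability (measurableTypeR R) R) (f : R -> R).

Definition reflect_fun (x : measurableTypeR R) : measurableTypeR R := (1 - x : R).

Lemma measurable_reflect : measurable_fun setT reflect_fun.
Proof. by apply: measurable_funB; [exact: measurable_cst|exact: measurable_id]. Qed.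

HB.instance Definition _ :=
  isMeasurableFun.Build _ _ _ _ reflect_fun measurable_reflect.

(** Every estimate ranges over all triadic measures, so it may be applied to the
    mirror image of P; this halves the case distinctions. *)
Definition reflection P : probability (measurableTypeR R) R :=
  distribution P reflect_fun.

Lemma triadic_reflection P : triadic_cantor P -> triadic_cantor (reflection P).
Proof.
move=> hP A mA; rewrite /reflection /= /distribution /pushforward hP; last first.
  by rewrite -[X in measurable X]setTI; apply: measurable_reflect.
congr (_ * _)%E; rewrite (reindex_inj rev_ord_inj) /=; apply: eq_bigr => j _.
congr (P _); apply/funext => x /=; congr A; rewrite /reflect_fun /simil.
by rewrite /= natrB // -[j.+1%:R]natr1; field.
Qed.

Lemma mean_reflection P f : nice f ->
  mean (reflection P) f = mean P (fun x => f (1 - x)).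
Proof.
move=> nf; have pre : reflect_fun @^-1` unitI R = unitI R.
  apply/funext => x; apply/propext; rewrite /= /unitI /reflect_fun /= !in_itv /=.
  split; lra.
rewrite /mean /Rintegral /reflection /= /distribution integral_pushforward.
- by rewrite pre.
- exact: measurable_reflect.
- by apply/measurable_EFinP; case: nf.
- by rewrite pre; apply: nice_integrable; exact: nice_reflect.
- exact: measurable_unitI.
Qed.

End Reflection.

Section SquareDistance.
Variable R : realType.
Implicit Types (s t : seq R) (x a : R).

(** The value at the first centre serves as the neutral element of the minimum,
    so that the formula is meaningful for nonempty s. *)
Definition sqdist s x : R :=
  \big[Num.min/(x - head 0 s) ^+ 2]_(a <- s) (x - a) ^+ 2.

Lemma sqdist_le s x a : a \in s -> sqdist s x <= (x - a) ^+ 2.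
Proof. by move=> sa; rewrite /sqdist; apply: bigmin_inf_seq sa _ _. Qed.

Lemma le_sqdist s x (y : R) : s != [::] ->
  (forall a, a \in s -> y <= (x - a) ^+ 2) -> y <= sqdist s x.
Proof.
case: s => // b s _ h; rewrite /sqdist big_seq; elim/big_ind: _ => [|u v yu yv|a]; last exact: h.
- by apply: h; rewrite mem_head.
- by rewrite le_min yu.
Qed.

Lemma sqdist_ge0 s x : 0 <= sqdist s x.
Proof.
rewrite /sqdist; elim/big_ind: _ => [|u v u0 v0|a _]; rewrite ?sqr_ge0 //.
by rewrite le_min u0.
Qed.

Lemma nice_sqdist s : nice (sqdist s).
Proof.
rewrite /sqdist; move: (head 0 s) => b.
have nd a : nice (fun x : R => (x - a) ^+ 2) by apply: niceX; apply: niceD.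
elim: s => [|a s IH].
  by under eq_fun do rewrite big_nil.
by under eq_fun do rewrite big_cons; exact: nice_min.
Qed.

Lemma sqdist_attained s x : s != [::] -> exists2 a, a \in s & sqdist s x = (x - a) ^+ 2.
Proof.
case: s => // b s _; rewrite /sqdist big_seq.
elim/big_ind: _ => [|u v [a sa ->] [c sc ->]|a sa]; [|by rewrite minEle; case: ifP => _;
  [exists a|exists c]|by exists a].
by exists b => //; rewrite mem_head.
Qed.

Lemma sqdist_affine (u v : R) s x : s != [::] -> u != 0 ->
  sqdist s (u * x + v) = u ^+ 2 * sqdist [seq (a - v) / u | a <- s] x.
Proof.
move=> s0 u0.
have s'0 : [seq (a - v) / u | a <- s] != [::] by case: s s0.
have E a : (u * x + v - a) ^+ 2 = u ^+ 2 * (x - (a - v) / u) ^+ 2 by field.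
apply/eqP; rewrite eq_le; apply/andP; split.
- have [_ /mapP[a sa ->] ->] := sqdist_attained x s'0.
  by rewrite -E; exact: sqdist_le.
- have [a sa ->] := sqdist_attained (u * x + v) s0.
  rewrite E ler_wpM2l ?sqr_ge0 //; apply: sqdist_le.
  by apply/mapP; exists a.
Qed.

Lemma nice_sqdist_affine s u v : s != [::] -> u != 0 ->
  nice (fun x => sqdist s (u * x + v)).
Proof.
move=> s0 u0.
rewrite (_ : (fun x => _) = fun x => u ^+ 2 * sqdist [seq (a - v) / u | a <- s] x).
  by apply: niceM => //; exact: nice_sqdist.
by apply/funext => x; rewrite sqdist_affine.
Qed.

End SquareDistance.

Section QuantizationError.
Variable R : realType.
Implicit Types (P : probability (measurableTypeR R) R) (s t : seq R).

Definition qerr P s : R := mean P (sqdist s).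

Lemma qerr_ge0 P s : 0 <= qerr P s.
Proof. by apply: Rintegral_ge0 => x _; exact: sqdist_ge0. Qed.

(** Each centre of t may be replaced, at each point separately, by a closer
    centre of s. *)
Lemma le_qerr P s t : t != [::] ->
  (forall x, 0 <= x <= 1 -> forall a, a \in t -> exists2 b, b \in s & (x - b) ^+ 2 <= (x - a) ^+ 2) ->
  qerr P s <= qerr P t.
Proof.
move=> t0 h; apply: mean_le; [exact: nice_sqdist|exact: nice_sqdist|].
move=> x hx; apply: le_sqdist => // a ta; have [b sb hb] := h x hx a ta.
exact: le_trans (sqdist_le x sb) hb.
Qed.

(** The centres s in the coordinates of the third number j: x/5 + 2j/5 is to a
    as x is to 5a - 2j, up to the ratio 5. *)
Definition magnify (j : nat) s : seq R := [seq 5 * a - 2 * j%:R | a <- s].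

Lemma qerr_thirds P s : triadic_cantor P -> s != [::] ->
  qerr P s = (qerr P (magnify 0 s) + qerr P (magnify 1 s) + qerr P (magnify 2 s)) / 75.
Proof.
move=> hP s0; rewrite /qerr (mean_thirds hP); last exact: nice_sqdist.
have E (j : nat) c : c = 2 / 5 * j%:R ->
    mean P (fun x => sqdist s (x / 5 + c)) = 25^-1 * mean P (sqdist (magnify j s)).
  move=> ->; rewrite -meanZ; last exact: nice_sqdist.
  apply: eq_mean => x _; rewrite [x / 5]mulrC sqdist_affine ?invr_eq0 //.
  congr (_ * sqdist _ _); first by field.
  by apply: eq_map => a; field.
have E0 : mean P (fun x => sqdist s (x / 5)) = 25^-1 * mean P (sqdist (magnify 0 s)).
  by rewrite -(E 0%N 0) ?mulr0 //; apply: eq_mean => x _; rewrite addr0.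
by rewrite E0 (E 1%N) ?(E 2%N) ?mulr1 //; field.
Qed.

Lemma qerr_reflection P s : s != [::] ->
  qerr (reflection P) s = qerr P [seq 1 - a | a <- s].
Proof.
move=> s0; rewrite /qerr mean_reflection; last exact: nice_sqdist.
apply: eq_mean => x _.
rewrite (_ : 1 - x = -1 * x + 1); last by ring.
rewrite sqdist_affine // ?oppr_eq0 ?oner_eq0 // sqrrN expr1n mul1r.
by congr sqdist; apply: eq_map => a; field.
Qed.

End QuantizationError.

(** * One and two centres *)

(** The quantization errors for 1, 2 and 3 points; 256 / 625 / 5 is the variance
    between the groups of masses 4/9 and 5/9 with means 9/50 and 189/250. *)
Definition V1 {R : realType} : R := 9^-1.
Definition V2 {R : realType} : R := 9^-1 - 256 / 625 / 5.
Definition V3 {R : realType} : R := 225^-1.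

Section TwoMeans.
Variable R : realType.
Implicit Types (P : probability (measurableTypeR R) R) (t x : R).

Definition absdev P t : R := mean P (fun x => `|x - t|).

Let nice_dist t : nice (fun x => `|x - t|).
Proof. by apply/nice_norm/niceD. Qed.

Section Values.
Variables (P : probability (measurableTypeR R) R) (hP : triadic_cantor P).

Lemma absdev_left t : t <= 0 -> absdev P t = 2^-1 - t.
Proof.
move=> t0; transitivity (mean P (fun x => 1 * x + - t)).
  by apply: eq_mean => x ?; rewrite ger0_norm; lra.
by rewrite (mean_line hP) mul1r.
Qed.

Lemma absdev_right t : 1 <= t -> absdev P t = t - 2^-1.
Proof.
move=> t0; transitivity (mean P (fun x => -1 * x + t)).
  by apply: eq_mean => x ?; rewrite ler0_norm; lra.
by rewrite (mean_line hP); field.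
Qed.

Lemma absdev_thirds t :
  absdev P t = (absdev P (5 * t) + absdev P (5 * t - 2) + absdev P (5 * t - 4)) / 15.
Proof.
rewrite /absdev (mean_thirds hP) //.
have E c u : u = 5 * t - 5 * c ->
    mean P (fun x => `|x / 5 + c - t|) = 5^-1 * mean P (fun x => `|x - u|).
  move=> ->; rewrite -meanZ //; apply: eq_mean => x _.
  have -> : x / 5 + c - t = 5^-1 * (x - (5 * t - 5 * c)) by field.
  by rewrite normrM ger0_norm.
have E0 : mean P (fun x => `|x / 5 - t|) = 5^-1 * mean P (fun x => `|x - 5 * t|).
  rewrite -(E 0) ?mulr0 ?subr0 //; apply: eq_mean => x _; by rewrite addr0.
rewrite E0 (E (2 / 5) (5 * t - 2)) ?(E (4 / 5) (5 * t - 4)); first by field.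
- by field.
- by field.
Qed.

Lemma absdev_convex t1 t2 t : t1 <= t <= t2 ->
  (t2 - t1) * absdev P t <= (t2 - t) * absdev P t1 + (t - t1) * absdev P t2.
Proof.
move=> /andP[h1 h2]; rewrite -!meanZ // -meanD //; try exact: niceM.
apply: mean_le.
- exact: niceM.
- by apply: niceD; exact: niceM.
move=> x _.
rewrite -[X in X * _ <= _]ger0_norm; last lra.
rewrite -[X in X * _ + _]ger0_norm; last lra.
rewrite -[X in _ + X * _]ger0_norm; last lra.
rewrite -!normrM; apply: le_trans (ler_normD _ _).
rewrite le_eqVlt; apply/orP; left; apply/eqP; congr `|_|; ring.
Qed.

Let thirds t u v w yu yv yw : 5 * t = u -> 5 * t - 2 = v -> 5 * t - 4 = w ->
  absdev P u = yu -> absdev P v = yv -> absdev P w = yw ->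
  absdev P t = (yu + yv + yw) / 15.
Proof. by move=> <- <- <- <- <- <-; exact: absdev_thirds. Qed.

(** The mean distance to a point outside [0, 1] is explicit, and [absdev_thirds]
    carries it to the ends of the gaps. *)
Lemma absdev_0 : absdev P 0 = 1 / 2.
Proof. by rewrite absdev_left //; lra. Qed.

Lemma absdev_1_5 : absdev P (1 / 5) = 11 / 30.
Proof.
rewrite (@thirds _ 1 (- 1) (- 3) (1 / 2) (3 / 2) (7 / 2)); try lra.
- by rewrite absdev_right; lra.
- by rewrite absdev_left; lra.
- by rewrite absdev_left; lra.
Qed.

Lemma absdev_4_5 : absdev P (4 / 5) = 11 / 30.
Proof.
rewrite (@thirds _ 4 2 0 (7 / 2) (3 / 2) (1 / 2)); try lra.
- by rewrite absdev_right; lra.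
- by rewrite absdev_right; lra.
- exact: absdev_0.
Qed.

Lemma absdev_2_5 : absdev P (2 / 5) = 3 / 10.
Proof.
rewrite (@thirds _ 2 0 (- 2) (3 / 2) (1 / 2) (5 / 2)); try lra.
- by rewrite absdev_right; lra.
- exact: absdev_0.
- by rewrite absdev_left; lra.
Qed.

Lemma absdev_11_25 : absdev P (11 / 25) = 131 / 450.
Proof.
rewrite (@thirds _ (11 / 5) (1 / 5) (- 9 / 5) (17 / 10) (11 / 30) (23 / 10)); try lra.
- by rewrite absdev_right; lra.
- exact: absdev_1_5.
- by rewrite absdev_left; lra.
Qed.

Lemma absdev_14_25 : absdev P (14 / 25) = 131 / 450.
Proof.
rewrite (@thirds _ (14 / 5) (4 / 5) (- 6 / 5) (23 / 10) (11 / 30) (17 / 10)); try lra.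
- by rewrite absdev_right; lra.
- exact: absdev_4_5.
- by rewrite absdev_left; lra.
Qed.

Lemma absdev_12_25 : absdev P (12 / 25) = 43 / 150.
Proof.
rewrite (@thirds _ (12 / 5) (2 / 5) (- 8 / 5) (19 / 10) (3 / 10) (21 / 10)); try lra.
- by rewrite absdev_right; lra.
- exact: absdev_2_5.
- by rewrite absdev_left; lra.
Qed.

Lemma absdev_61_125 : absdev P (61 / 125) <= 103 / 360.
Proof.
rewrite (@thirds _ (61 / 25) (11 / 25) (- 39 / 25) (97 / 50) (131 / 450) (103 / 50)); try lra.
- by rewrite absdev_right; lra.
- exact: absdev_11_25.
- by rewrite absdev_left; lra.
Qed.

Lemma absdev_64_125 : absdev P (64 / 125) <= 103 / 360.
Proof.
rewrite (@thirds _ (64 / 25) (14 / 25) (- 36 / 25) (103 / 50) (131 / 450) (97 / 50)); try lra.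
- by rewrite absdev_right; lra.
- exact: absdev_14_25.
- by rewrite absdev_left; lra.
Qed.

(** Convexity bounds the mean distance by its chords, and it remains to compare
    a straight line with a hyperbola. *)
Lemma absdev_sqr_chord t t1 t2 m k : absdev P t1 <= k - m * t1 -> absdev P t2 <= k - m * t2 ->
  (forall u : R, (k - m * u) ^+ 2 <= 256 / 625 / 5 + (u - 1 / 2) ^+ 2) ->
  t1 < t2 -> t1 <= t <= t2 -> absdev P t ^+ 2 <= 256 / 625 / 5 + (t - 1 / 2) ^+ 2.
Proof.
move=> h1 h2 hu t12 ht; apply: le_trans (hu t).
have A0 : 0 <= absdev P t by apply: Rintegral_ge0.
have le_line : absdev P t <= k - m * t.
  have /andP[? ?] := ht.
  rewrite -(ler_pM2l (x := t2 - t1)) ?subr_gt0 //.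
  apply: le_trans (absdev_convex ht) _.
  have : (t2 - t) * absdev P t1 <= (t2 - t) * (k - m * t1) by rewrite ler_wpM2l ?subr_ge0.
  have : (t - t1) * absdev P t2 <= (t - t1) * (k - m * t2) by rewrite ler_wpM2l ?subr_ge0.
  nra.
by rewrite lerXn2r ?nnegrE // (le_trans A0).
Qed.

(** The chords run between consecutive ends of gaps; the central one jumps over
    the middle cylinder of level 3.  The hints are abscissae at or near which
    the chord comes closest to the hyperbola. *)
Lemma absdev_sqr_half t : t <= 1 / 2 ->
  absdev P t ^+ 2 <= 256 / 625 / 5 + (t - 1 / 2) ^+ 2.
Proof.
move=> ht.
have [t0|t0] := lerP t 0.
  rewrite absdev_left // -[X in X - t]mul1r -sqrrN opprB lerDr; lra.
have [t1|t1] := lerP t (1 / 5).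
  apply: (@absdev_sqr_chord _ 0 (1 / 5) (2 / 3) (1 / 2)); try lra.
  - by rewrite absdev_0; lra.
  - by rewrite absdev_1_5; lra.
  - by move=> u; have := sqr_ge0 (u - 3 / 10); lra.
have [t2|t2] := lerP t (2 / 5).
  apply: (@absdev_sqr_chord _ (1 / 5) (2 / 5) (1 / 3) (13 / 30)); try lra.
  - by rewrite absdev_1_5; lra.
  - by rewrite absdev_2_5; lra.
  - by move=> u; have := sqr_ge0 (u - 2 / 5); lra.
have [t3|t3] := lerP t (11 / 25).
  apply: (@absdev_sqr_chord _ (2 / 5) (11 / 25) (2 / 9) (7 / 18)); try lra.
  - by rewrite absdev_2_5; lra.
  - by rewrite absdev_11_25; lra.
  - by move=> u; have := sqr_ge0 (u - 67 / 154); lra.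
have [t4|t4] := lerP t (12 / 25).
  apply: (@absdev_sqr_chord _ (11 / 25) (12 / 25) (1 / 9) (17 / 50)); try lra.
  - by rewrite absdev_11_25; lra.
  - by rewrite absdev_12_25; lra.
  - by move=> u; have := sqr_ge0 (u - 117 / 250); lra.
have [t5|t5] := lerP t (61 / 125).
  apply: (@absdev_sqr_chord _ (12 / 25) (61 / 125) (5 / 72) (8 / 25)); try lra.
  - by rewrite absdev_12_25; lra.
  - by apply: le_trans absdev_61_125 _; lra.
  - by move=> u; have := sqr_ge0 (u - 12 / 25); nra.
apply: (@absdev_sqr_chord _ (61 / 125) (64 / 125) 0 (103 / 360)); try lra.
- by apply: le_trans absdev_61_125 _; lra.
- by apply: le_trans absdev_64_125 _; lra.
- by move=> u; have := sqr_ge0 (u - 1 / 2); lra.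
Qed.

End Values.

Lemma absdev_reflection P t : absdev (reflection P) t = absdev P (1 - t).
Proof.
rewrite /absdev mean_reflection //; apply: eq_mean => x _.
rewrite -normrN; congr `|_|; ring.
Qed.

Lemma absdev_sqr P t : triadic_cantor P ->
  absdev P t ^+ 2 <= 256 / 625 / 5 + (t - 1 / 2) ^+ 2.
Proof.
move=> hP; have [h|h] := lerP t (1 / 2); first exact: absdev_sqr_half.
have := @absdev_sqr_half _ (triadic_reflection hP) (1 - t).
rewrite absdev_reflection subKr => /(_ _)/le_trans; apply; first lra.
by rewrite le_eqVlt; apply/orP; left; apply/eqP; field.
Qed.

Lemma qerr_ge1 P s : triadic_cantor P -> (size s = 1)%N -> V1 <= qerr P s.
Proof.
case: s => // a [|//] hP _; rewrite /V1 -[9^-1]addr0.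
apply: (le_trans (lerD (lexx _) (sqr_ge0 (a - 2^-1)))).
rewrite -(mean_sqr_dist hP); apply: mean_le.
- by apply: niceX; apply: niceD.
- exact: nice_sqdist.
- by move=> x _; apply: le_sqdist => // b; rewrite inE => /eqP ->.
Qed.

(** Minimising (|x - t| - h)^2 in mean over h leaves
    1/9 + (t - 1/2)^2 - (E|X - t|)^2. *)
Lemma qerr_ge2 P s : triadic_cantor P -> (size s = 2)%N -> V2 <= qerr P s.
Proof.
case: s => // a [//|b [|//]] hP _.
pose t := (a + b) / 2; pose h := `|a - b| / 2.
have le_mean : mean P (fun x => (x - t) ^+ 2 + ((- 2 * h) * `|x - t| + h ^+ 2)) <=
    qerr P [:: a; b].
  apply: mean_le.
  - apply: niceD; first by apply: niceX; apply: niceD.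
    by apply: niceD => //; apply: niceM.
  - exact: nice_sqdist.
  - move=> x _; apply: le_sqdist => // c.
    rewrite !inE /h /t => /orP[] /eqP ->.
      by case: (ger0P (a - b)) => ?; case: (ger0P (x - _)) => ?; nra.
    by case: (ger0P (a - b)) => ?; case: (ger0P (x - _)) => ?; nra.
apply: le_trans le_mean.
have -> : mean P (fun x => (x - t) ^+ 2 + ((- 2 * h) * `|x - t| + h ^+ 2)) =
    9^-1 + (t - 2^-1) ^+ 2 + ((- 2 * h) * absdev P t + h ^+ 2).
  rewrite meanD; [|by apply: niceX; apply: niceD|by apply: niceD => //; apply: niceM].
  rewrite meanD //; last exact: niceM.
  by rewrite meanZ // mean_cst // mean_sqr_dist.
rewrite /V2; have := absdev_sqr t hP; have := sqr_ge0 (h - absdev P t); nra.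
Qed.

End TwoMeans.

(** * Sets of centres seen from one third of the Cantor set *)

(** A bound for what a third owning a single centre may gain from a foreign one;
    17/200 has to satisfy both [qerr_single] and [qerr_owner_both]. *)
Definition deficit {R : realType} : R := V1 - 17 / 200.

Section Pieces.
Variable R : realType.
Variables (P : probability (measurableTypeR R) R).
Hypothesis hP : triadic_cantor P.
Implicit Types (s o : seq R) (a b c x y : R).

Lemma sqr_dist_le_left y a b : b - y <= y - a -> y - b <= y - a ->
  (y - b) ^+ 2 <= (y - a) ^+ 2.
Proof. by move=> h1 h2; nra. Qed.

Lemma sqr_dist_le_right y a b : b - y <= a - y -> y - b <= a - y ->
  (y - b) ^+ 2 <= (y - a) ^+ 2.
Proof. by move=> h1 h2; nra. Qed.

(** The mean squared distance over the third starting at c = 0, 2/5 or 4/5. *)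
Definition piece s c : R := mean P (fun x => sqdist s (x / 5 + c)).

Lemma qerr_pieces s : qerr P s = (piece s 0 + piece s (2 / 5) + piece s (4 / 5)) / 3.
Proof.
rewrite /qerr (mean_thirds hP); last exact: nice_sqdist.
by rewrite (@eq_mean _ _ _ (fun x => sqdist s (x / 5 + 0))) // => x _; rewrite addr0.
Qed.

Let nice_piece s c : s != [::] -> nice (fun x => sqdist s (x / 5 + c)).
Proof.
move=> s0; rewrite (_ : (fun x => _) = fun x => sqdist s (5^-1 * x + c)).
  by apply: nice_sqdist_affine; rewrite ?invr_eq0.
by apply/funext => x; rewrite [x / 5]mulrC.
Qed.

Lemma piece_ge0 s c : 0 <= piece s c.
Proof. by apply: Rintegral_ge0 => x _; exact: sqdist_ge0. Qed.

(** When b beats all centres throughout the third, this mean is at least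
    that for the single centre b, namely the variance 1/225 of the third plus the
    squared distance from b to its midpoint c + 1/10. *)
Lemma piece_ge_sqr s c b : s != [::] ->
  (forall y, c <= y <= c + 1 / 5 -> forall a, a \in s -> (y - b) ^+ 2 <= (y - a) ^+ 2) ->
  225^-1 + (c + 1 / 10 - b) ^+ 2 <= piece s c.
Proof.
move=> s0 h; have -> : 225^-1 + (c + 1 / 10 - b) ^+ 2 =
    mean P (fun x => (5^-1 * x + (c - b)) ^+ 2) by rewrite (mean_sqr_affine hP); field.
apply: mean_le; [by apply: niceX; apply: niceD => //; exact: niceM|exact: nice_piece|].
move=> x hx; apply: le_sqdist => // a sa.
have -> : 5^-1 * x + (c - b) = x / 5 + c - b by ring.
by apply: h => //; lra.
Qed.

Lemma piece_ge_cst s c k : s != [::] ->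
  (forall y, c <= y <= c + 1 / 5 -> forall a, a \in s -> k <= (y - a) ^+ 2) ->
  k <= piece s c.
Proof.
move=> s0 h; rewrite -[X in X <= _](mean_cst hP).
apply: mean_le; [exact: nice_cst|exact: nice_piece|].
move=> x hx; apply: le_sqdist => // a sa; by apply: h => //; lra.
Qed.

(** The last third is then at distance at least 3/10 from every centre, and 1/2
    would serve it best. *)
Lemma qerr_ge_left s : s != [::] -> (forall a, a \in s -> a <= 1 / 2 \/ 3 / 2 <= a) ->
  (225^-1 + 4 / 25) / 3 <= qerr P s.
Proof.
move=> s0 h; rewrite qerr_pieces.
have := piece_ge0 s 0; have := piece_ge0 s (2 / 5).
have : 225^-1 + (4 / 5 + 1 / 10 - 1 / 2) ^+ 2 <= piece s (4 / 5).
  apply: piece_ge_sqr => // y hy a /h [?|?].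
    by apply: sqr_dist_le_left; lra.
  by apply: sqr_dist_le_right; lra.
lra.
Qed.

Lemma qerr_ge_right s : s != [::] -> (forall a, a \in s -> a <= - (1 / 2) \/ 1 / 2 <= a) ->
  (225^-1 + 4 / 25) / 3 <= qerr P s.
Proof.
move=> s0 h; rewrite qerr_pieces.
have := piece_ge0 s (4 / 5); have := piece_ge0 s (2 / 5).
have : 225^-1 + (0 + 1 / 10 - 1 / 2) ^+ 2 <= piece s 0.
  apply: piece_ge_sqr => // y hy a /h [?|?].
    by apply: sqr_dist_le_left; lra.
  by apply: sqr_dist_le_right; lra.
lra.
Qed.

Lemma qerr_ge_outside s k : s != [::] -> 0 <= k ->
  (forall a, a \in s -> a <= - k \/ 1 + k <= a) -> k ^+ 2 <= qerr P s.
Proof.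
move=> s0 k0 h; rewrite -(mean_cst hP (k ^+ 2)); apply: mean_le => //.
  exact: nice_sqdist.
move=> x hx; apply: le_sqdist => // a /h [?|?]; nra.
Qed.

(** The centres s of a magnified third, those in o being its own.  Closed
    conditions on both sides keep the notion invariant under reflection. *)
Definition owns s o : Prop :=
  (forall a, a \in o -> - (1 / 2) <= a <= 3 / 2) /\
  (forall a, a \in s -> [\/ a \in o, a <= - (1 / 2) | 3 / 2 <= a]).

(** If o has centres on both sides of 1/2 then, for x in [0, 1], each foreign
    centre is farther than one of them, and the hypothesis on sets applies to o.
    Otherwise one end of the third, or all of it, is far from all centres. *)
Lemma qerr_owns (psi : nat -> R) s o : s != [::] -> owns s o ->
  psi 0%N <= 1 / 4 -> (forall n, (0 < n)%N -> psi n <= (225^-1 + 4 / 25) / 3) ->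
  (forall t, t != [::] -> psi (size t) <= qerr P t) ->
  psi (size o) <= qerr P s.
Proof.
move=> s0 [ho hs] psi0 psi1 IH.
have [e0|o0] := eqVneq o [::].
  rewrite e0; apply: le_trans psi0 _; rewrite (_ : 1 / 4 = (1 / 2) ^+ 2); last by field.
  apply: qerr_ge_outside => // a /hs[|?|?]; [by rewrite e0|left; lra|right; lra].
have psz : (0 < size o)%N by case: (o) o0.
have [/allP allL|/allPn[a ao aL]] := boolP (all (fun a => a <= 1 / 2) o).
  apply: (le_trans (psi1 _ psz)); apply: qerr_ge_left => // a.
  by move=> /hs[/allL ?|?|?]; [left|left; lra|right].
have [/allP allR|/allPn[b bo bR]] := boolP (all (fun a => 1 / 2 <= a) o).
  apply: (le_trans (psi1 _ psz)); apply: qerr_ge_right => // c.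
  by move=> /hs[/allR ?|?|?]; [right|left|right; lra].
move: aL bR; rewrite -!ltNge => aL bR.
have /andP[_ a1] := ho _ ao.
have /andP[b0 _] := ho _ bo.
apply: (le_trans (IH _ o0)); apply: le_qerr => // x hx c /hs[co|?|?].
- by exists c.
- by exists b => //; apply: sqr_dist_le_left; lra.
- by exists a => //; apply: sqr_dist_le_right; lra.
Qed.

(** The own centre b cannot be good both for the last third, where the foreign
    centres do not come closer than 1/2, and for the first two. *)
Lemma qerr_single s b : s != [::] -> owns s [:: b] -> b <= 1 / 2 ->
  V1 - deficit <= qerr P s.
Proof.
move=> s0 [_ hs] hb; rewrite /deficit subKr.
have {}hs : forall a, a \in s -> [\/ a = b, a <= - (1 / 2) | 3 / 2 <= a].
  by move=> a /hs [|?|?]; [rewrite inE => /eqP; constructor 1|constructor 2|constructor 3].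
rewrite qerr_pieces.
have := piece_ge0 s 0; have := piece_ge0 s (2 / 5); have := piece_ge0 s (4 / 5).
have [b0|b0] := lerP b 0.
  have : (2 / 5) ^+ 2 <= piece s (2 / 5).
    by apply: piece_ge_cst => // y hy a /hs [?|?|?]; nra.
  have : (1 / 2) ^+ 2 <= piece s (4 / 5).
    by apply: piece_ge_cst => // y hy a /hs [?|?|?]; nra.
  lra.
have : 225^-1 + (0 + 1 / 10 - b) ^+ 2 <= piece s 0.
  apply: piece_ge_sqr => // y hy a /hs [->|?|?] //.
    by apply: sqr_dist_le_left; lra.
  by apply: sqr_dist_le_right; lra.
have : 225^-1 + (2 / 5 + 1 / 10 - b) ^+ 2 <= piece s (2 / 5).
  apply: piece_ge_sqr => // y hy a /hs [->|?|?] //.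
    by apply: sqr_dist_le_left; lra.
  by apply: sqr_dist_le_right; lra.
(* On [0, 9/25] the last third is far from b, beyond it the first two are. *)
have [b1|b1] := lerP b (9 / 25).
  have : (11 / 25) ^+ 2 <= piece s (4 / 5).
    by apply: piece_ge_cst => // y hy a /hs [?|?|?]; nra.
  have := sqr_ge0 (b - 3 / 10); lra.
have : 225^-1 + (4 / 5 + 1 / 10 - 1 / 2) ^+ 2 <= piece s (4 / 5).
  apply: piece_ge_sqr => // y hy a /hs [?|?|?].
  - by apply: sqr_dist_le_left; lra.
  - by apply: sqr_dist_le_left; lra.
  - by apply: sqr_dist_le_right; lra.
nra.
Qed.

(** If b is at least 2/5, centres from 8/5 on help no point of [0, 1]; if b is
    less, the last third is too far from all centres. *)
Lemma qerr_single_far s b : s != [::] -> - (1 / 2) <= b <= 1 / 2 ->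
  (forall a, a \in s -> [\/ a = b, a <= - (1 / 2) | 8 / 5 <= a]) ->
  V1 <= qerr P s.
Proof.
move=> s0 /andP[hb0 hb1] hs; rewrite /V1.
have [b1|b1] := lerP (2 / 5) b.
  rewrite -[9^-1]addr0; apply: (le_trans (lerD (lexx _) (sqr_ge0 (b - 2^-1)))).
  rewrite -(mean_sqr_dist hP); apply: mean_le.
  - by apply: niceX; apply: niceD.
  - exact: nice_sqdist.
  - move=> x hx; apply: le_sqdist => // a /hs[->|?|?] //.
      by apply: sqr_dist_le_left; lra.
    by apply: sqr_dist_le_right; lra.
rewrite qerr_pieces.
have := piece_ge0 s 0; have := piece_ge0 s (2 / 5); have := piece_ge0 s (4 / 5).
have [b0|b0] := lerP b 0.
  have : (2 / 5) ^+ 2 <= piece s (2 / 5).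
    by apply: piece_ge_cst => // y hy a /hs [?|?|?]; nra.
  have : (1 / 2) ^+ 2 <= piece s (4 / 5).
    by apply: piece_ge_cst => // y hy a /hs [?|?|?]; nra.
  lra.
have : 225^-1 + (0 + 1 / 10 - b) ^+ 2 <= piece s 0.
  apply: piece_ge_sqr => // y hy a /hs [->|?|?] //.
    by apply: sqr_dist_le_left; lra.
  by apply: sqr_dist_le_right; lra.
have : 225^-1 + (2 / 5 + 1 / 10 - b) ^+ 2 <= piece s (2 / 5).
  apply: piece_ge_sqr => // y hy a /hs [->|?|?] //.
    by apply: sqr_dist_le_left; lra.
  by apply: sqr_dist_le_right; lra.
have : 225^-1 + (4 / 5 + 1 / 10 - 2 / 5) ^+ 2 <= piece s (4 / 5).
  apply: piece_ge_sqr => // y hy a /hs [?|?|?].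
  - by apply: sqr_dist_le_left; lra.
  - by apply: sqr_dist_le_left; lra.
  - by apply: sqr_dist_le_right; lra.
have := sqr_ge0 (b - 3 / 10); lra.
Qed.

(** Centres left of -2/5 are too far away to serve much of the third, and those
    right of 3/2 come no closer than 1/2, so b is almost alone.  The bound is
    checked on four ranges of b; 19/50 balances the loss on the last third
    against that on the first. *)
Lemma qerr_pair s b : s != [::] -> - (1 / 2) <= b <= 3 / 2 ->
  (forall a, a \in s -> [\/ a = b, a <= - (2 / 5) | 3 / 2 <= a]) ->
  V2 + deficit <= qerr P s.
Proof.
move=> s0 /andP[hb0 hb1] hs; rewrite /deficit /V1 /V2.
rewrite qerr_pieces.
have := piece_ge0 s 0; have := piece_ge0 s (2 / 5); have := piece_ge0 s (4 / 5).
have [b1|b1] := lerP b (19 / 50).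
  have : (21 / 50) ^+ 2 <= piece s (4 / 5).
    by apply: piece_ge_cst => // y hy a /hs [?|?|?]; nra.
  lra.
have : 225^-1 + (0 + 1 / 10 - 19 / 50) ^+ 2 <= piece s 0.
  apply: piece_ge_sqr => // y hy a /hs [?|?|?] //.
  - by apply: sqr_dist_le_right; lra.
  - by apply: sqr_dist_le_left; lra.
  - by apply: sqr_dist_le_right; lra.
have [b2|b2] := lerP b (1 / 2).
  have : 225^-1 + (4 / 5 + 1 / 10 - 1 / 2) ^+ 2 <= piece s (4 / 5).
    apply: piece_ge_sqr => // y hy a /hs [?|?|?].
    - by apply: sqr_dist_le_left; lra.
    - by apply: sqr_dist_le_left; lra.
    - by apply: sqr_dist_le_right; lra.
  lra.
have [b3|b3] := lerP 1 b.
  have : (2 / 5) ^+ 2 <= piece s (2 / 5).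
    by apply: piece_ge_cst => // y hy a /hs [?|?|?]; nra.
  lra.
have : 225^-1 + (2 / 5 + 1 / 10 - b) ^+ 2 <= piece s (2 / 5).
  apply: piece_ge_sqr => // y hy a /hs [->|?|?] //.
    by apply: sqr_dist_le_left; lra.
  by apply: sqr_dist_le_right; lra.
have : 225^-1 + (4 / 5 + 1 / 10 - b) ^+ 2 <= piece s (4 / 5).
  apply: piece_ge_sqr => // y hy a /hs [->|?|?] //.
    by apply: sqr_dist_le_left; lra.
  by apply: sqr_dist_le_right; lra.
have := sqr_ge0 (b - 7 / 10); lra.
Qed.

(** An own centre left of -2/5 is nearly wasted: with one or two own centres the
    distortion is large, and with three their number alone pays. *)
Lemma qerr_owner_left s o c : s != [::] -> owns s o -> c \in o -> c <= - (2 / 5) ->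
  V1 + (V1 - V2) + deficit <= qerr P s + (size o)%:R * (V1 - V2).
Proof.
move=> s0 [ho hs] co hc; have q0 := qerr_ge0 P s.
have two b : b \in o -> (forall a, a \in o -> a = c \/ a = b) -> V2 + deficit <= qerr P s.
  move=> bo ocb; apply: (@qerr_pair _ b) => // [|a]; first exact: ho.
  move=> /hs[/ocb[->|->]|?|?]; [by constructor 2|by constructor 1|constructor 2; lra|].
  by constructor 3.
case: o co ho hs two => [//|a1 [|a2 [|a3 o]]] co ho hs two.
- have : (2 / 5) ^+ 2 <= qerr P s.
    apply: qerr_ge_outside => // a /hs[|?|?]; [|by left; lra|by right; lra].
    by move: co; rewrite !inE => /eqP <- /eqP ->; left.
  rewrite /deficit /V1 /V2 /=; lra.
- suff : V2 + deficit <= qerr P s by rewrite /deficit /V1 /V2 /=; lra.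
  move: co; rewrite !inE => /orP[]/eqP ec.
    by apply: (two a2) => [|a]; rewrite !inE ?eqxx ?orbT // ec => /orP[]/eqP; [left|right].
  by apply: (two a1) => [|a]; rewrite !inE ?eqxx // ec => /orP[]/eqP; [right|left].
- have : 3 <= (size [:: a1, a2, a3 & o])%:R :> R by rewrite ler_nat.
  by move: (size _)%:R => n; rewrite /deficit /V1 /V2; lra.
Qed.

(** Two wasted centres.  Three centres pay for two deficits with little room to
    spare, which is what fixes the size of [deficit]. *)
Lemma qerr_owner_both s o c d : s != [::] -> owns s o ->
  c \in o -> c <= - (2 / 5) -> d \in o -> 7 / 5 <= d ->
  V1 + (V1 - V2) + 2 * deficit <= qerr P s + (size o)%:R * (V1 - V2).
Proof.
move=> s0 [ho hs] co hc od hd; have q0 := qerr_ge0 P s.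
case: o co od ho hs => [//|a1 [|a2 [|a3 o]]] co od ho hs.
- by move: co od; rewrite !inE => /eqP ? /eqP ?; lra.
- have : (2 / 5) ^+ 2 <= qerr P s.
    apply: qerr_ge_outside => // a /hs[|?|?]; [|left; lra|right; lra].
    move: co od; rewrite !inE => /orP[]/eqP ? /orP[]/eqP ? /orP[]/eqP ?;
      solve [lra|left; lra|right; lra].
  rewrite /deficit /V1 /V2 /=; lra.
- have : 3 <= (size [:: a1, a2, a3 & o])%:R :> R by rewrite ler_nat.
  by move: (size _)%:R => n; rewrite /deficit /V1 /V2; lra.
Qed.
End Pieces.

(** * Lower bounds by lines *)

Section LowerBounds.
Variable R : realType.
Implicit Types (P : probability (measurableTypeR R) R) (s o : seq R).

(** Quantifying over all triadic measures allows reflections inside proofs. *)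
Definition lower_bound (psi : nat -> R) : Prop :=
  forall P, triadic_cantor P -> forall s, s != [::] -> psi (size s) <= qerr P s.

(** The line n |-> (3^l u - n w) / 75^l.  With u = 2 V1 - V2, w = V1 - V2 it joins
    V1 / 25^l at 3^l to V2 / 25^l at 2 * 3^l; with u = 3 V2 - 2 V3, w = V2 - V3 it
    joins V2 / 25^l at 2 * 3^l to V3 / 25^l at 3^(l+1). *)
Definition line (u w : R) (l n : nat) : R := (3 ^+ l * u - n%:R * w) / 75 ^+ l.

(** From three points on the line is negative. *)
Lemma lower_bound_base : lower_bound (line (V1 + (V1 - V2)) (V1 - V2) 0).
Proof.
move=> P hP s s0; rewrite /line !expr0 mul1r divr1.
have [e1|n1] := eqVneq (size s) 1%N.
  by have := qerr_ge1 hP e1; rewrite e1; lra.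
have [e2|n2] := eqVneq (size s) 2%N.
  by have := qerr_ge2 hP e2; rewrite e2; lra.
have : 3 <= (size s)%:R :> R.
  by rewrite ler_nat; case: s s0 n1 n2 => // a [|b [|c s]].
by have := qerr_ge0 P s; rewrite /V1 /V2; lra.
Qed.

Let flip s : seq R := [seq 1 - a | a <- s].

Let flipK s : flip (flip s) = s.
Proof. by rewrite /flip -map_comp map_id_in // => a _ /=; rewrite subKr. Qed.

Let mem_flip s a : (a \in flip s) = (1 - a \in s).
Proof.
apply/mapP/idP => [[b sb ->]|sa]; first by rewrite subKr.
by exists (1 - a); rewrite ?subKr.
Qed.

Let flip_nil s : (flip s == [::]) = (s == [::]).
Proof. by case: s. Qed.

Let qerr_flip P s : s != [::] -> qerr (reflection P) (flip s) = qerr P s.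
Proof. by move=> s0; rewrite qerr_reflection ?flip_nil // -/(flip _) flipK. Qed.

Let owns_flip s o : owns s o -> owns (flip s) (flip o).
Proof.
move=> [ho hs]; split => a; rewrite mem_flip.
  by move=> /ho; lra.
by move=> /hs[?|?|?]; [constructor 1; rewrite mem_flip|constructor 3; lra|constructor 2; lra].
Qed.

Lemma qerr_owner_right P s o c : triadic_cantor P -> s != [::] -> owns s o ->
  c \in o -> 7 / 5 <= c ->
  V1 + (V1 - V2) + deficit <= qerr P s + (size o)%:R * (V1 - V2).
Proof.
move=> hP s0 so co hc.
have := @qerr_owner_left _ _ (triadic_reflection hP) (flip s) (flip o) (1 - c).
rewrite flip_nil mem_flip subKr qerr_flip // size_map => h.
by apply: (h s0 (owns_flip so) co); lra.
Qed.

(** A centre b on the left half makes the foreign centres on the left useless,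
    so only those on the right can cause a deficit. *)
Let qerr_single_left P s b : triadic_cantor P -> s != [::] -> owns s [:: b] -> b <= 1 / 2 ->
  V1 <= qerr P s \/ V1 - deficit <= qerr P s /\
    exists a, [/\ a \in s, a != b & 3 / 2 <= a <= 8 / 5].
Proof.
move=> hP s0 so hb.
pose near a := (a != b) && (3 / 2 <= a <= 8 / 5).
have [/hasP[a sa /andP[ab ha]]|/hasPn nn] := boolP (has near s).
  right; split; last by exists a.
  exact: (qerr_single hP s0 so hb).
left; have [ho hs] := so.
have /andP[b0 _] := ho b (mem_head _ _).
apply: (qerr_single_far hP s0 (b := b)); first by apply/andP.
move=> a sa; have := nn a sa; rewrite /near negb_and negbK => /orP[/eqP ->|na].
  by constructor 1.
case: (hs a sa) => [|?|?]; first by rewrite inE => /eqP; constructor 1.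
  by constructor 2.
by constructor 3; move: na; rewrite negb_and -!ltNge => /orP[]; lra.
Qed.

(** Only a third with exactly one own centre can fall below the line, and then a
    foreign centre lies within 8/5 of its far end. *)
Lemma qerr_deficit P s o : triadic_cantor P -> s != [::] -> owns s o ->
  V1 + (V1 - V2) <= qerr P s + (size o)%:R * (V1 - V2) \/
  V1 + (V1 - V2) - deficit <= qerr P s + (size o)%:R * (V1 - V2) /\
  exists a, [/\ a \in s, a \notin o & 3 / 2 <= a <= 8 / 5 \/ - (3 / 5) <= a <= - (1 / 2)].
Proof.
move=> hP s0 so.
case: (ltngtP (size o) 1) => [sz|sz|/eqP].
- left; case: o sz so => // _ [_ hs].
  have : (1 / 2) ^+ 2 <= qerr P s.
    by apply: qerr_ge_outside => // a /hs[|?|?]; [rewrite in_nil|left; lra|right; lra].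
  rewrite /V1 /V2 /=; lra.
(* With 2 points or more the line is small enough for the one-sided bound. *)
- left; pose psi n := if (n <= 1)%N then 0 else line (V1 + (V1 - V2)) (V1 - V2) 0 n.
  have : psi (size o) <= qerr P s.
    apply: qerr_owns => //.
    + by rewrite /psi /=; lra.
    + move=> n _; rewrite /psi; case: ltnP => hn; last lra.
      have : 2 <= n%:R :> R by rewrite ler_nat.
      by rewrite /line !expr0 mul1r divr1 /V1 /V2; lra.
    + move=> t t0; rewrite /psi; case: ltnP => hn; last exact: qerr_ge0.
      exact: lower_bound_base.
  by rewrite /psi leqNgt sz /= /line !expr0 mul1r divr1; lra.
case: o so => // b [|//] so _ /=.
have [b1|b1] := lerP b (1 / 2).
  have [?|[? [a [sa ab ha]]]] := qerr_single_left hP s0 so b1; [left; lra|right].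
  by split; [lra|exists a; rewrite inE ab; split => //; left].
have := @qerr_single_left _ (flip s) (1 - b) (triadic_reflection hP).
rewrite flip_nil qerr_flip // => /(_ s0 (owns_flip so)) h.
have [|?|[? [a [sa ab ha]]]] := h; [lra|left; lra|right].
split; first lra.
exists (1 - a); rewrite -mem_flip; split => //; last by right; lra.
by rewrite inE; apply: contra ab => /eqP <-; rewrite subKr.
Qed.


(** Moving the centres into [0, 1] brings them closer to all of [0, 1]; the
    outer thirds then have foreign centres on one side only. *)
Let clamp (a : R) : R := Num.max 0 (Num.min 1 a).

Let clamp_unit a : 0 <= clamp a <= 1.
Proof. by rewrite /clamp maxEle minEle; case: ifP; case: ifP => ? ?; lra. Qed.

Let qerr_clamp P s : s != [::] -> qerr P (map clamp s) <= qerr P s.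
Proof.
move=> s0; apply: le_qerr => // x hx a sa; exists (clamp a); first exact: map_f.
rewrite /clamp maxEle minEle.
case: (lerP 1 a) => ?; case: ifP => ?; first [nra|lra].
Qed.

Let own0 s := [seq a <- s | a < 3 / 10].
Let own1 s := [seq a <- s | 3 / 10 <= a < 7 / 10].
Let own2 s := [seq a <- s | 7 / 10 <= a].

Let size_own s : (size (own0 s) + size (own1 s) + size (own2 s) = size s)%N.
Proof.
have low_high (b : R) : b < 3 / 10 -> 7 / 10 <= b -> False by lra.
elim: s => //= a s IH; rewrite /own0 /own1 /own2 /= in IH *.
case: (ltP a (3 / 10)) => h1; case: (ltP a (7 / 10)) => h2 /=;
  try by rewrite -IH ?addSn ?addnS.
by case: (low_high a h1 h2).
Qed.

Let mem_magnify j s a : (a \in magnify j s) = (a / 5 + 2 / 5 * j%:R \in s).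
Proof.
apply/mapP/idP => [[b sb ->]|sa].
  by rewrite (_ : (_ - _) / 5 + _ = b) //; field.
by exists (a / 5 + 2 / 5 * j%:R) => //; field.
Qed.

Let magnify_nil j s : (magnify j s == [::]) = (s == [::]).
Proof. by case: s. Qed.

Section Unit.
Variable s : seq R.
Hypothesis s_unit : forall a, a \in s -> 0 <= a <= 1.

Let owns0 : owns (magnify 0 s) (magnify 0 (own0 s)).
Proof.
split => a; rewrite !mem_magnify mulr0 addr0 !mem_filter => h.
  by case/andP: h => ? /s_unit; lra.
have := s_unit h; case: ltP => ? ?; [constructor 1; exact: h|constructor 3; lra].
Qed.

Let owns1 : owns (magnify 1 s) (magnify 1 (own1 s)).
Proof.
split => a; rewrite !mem_magnify mulr1 !mem_filter => h.
  by case/andP: h => ? /s_unit; lra.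
rewrite h andbT.
have [h1|h1] := lerP (3 / 10) (a / 5 + 2 / 5); last by constructor 2; lra.
have [h2|h2] := ltP (a / 5 + 2 / 5) (7 / 10); [by constructor 1|constructor 3; lra].
Qed.

Let owns2 : owns (magnify 2 s) (magnify 2 (own2 s)).
Proof.
split => a; rewrite !mem_magnify !mem_filter => h.
  by case/andP: h => ? /s_unit; lra.
rewrite h andbT.
have [h1|h1] := lerP (7 / 10) (a / 5 + 2 / 5 * 2); [by constructor 1|constructor 2; lra].
Qed.

(** Lines being affine, the line of level l+1 at the number of centres is 1/75 of
    the sum of the lines of level l at the numbers of centres owned. *)
Lemma line_step_unit P u w l : triadic_cantor P -> s != [::] ->
  line u w l 0 <= 1 / 4 ->
  (forall n, (0 < n)%N -> line u w l n <= (225^-1 + 4 / 25) / 3) ->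
  lower_bound (line u w l) -> line u w l.+1 (size s) <= qerr P s.
Proof.
move=> hP s0 l0 l1 lb; rewrite (qerr_thirds hP s0).
have E j o : owns (magnify j s) (magnify j o) ->
    line u w l (size o) <= qerr P (magnify j s).
  move=> so; rewrite -(size_map (fun a => 5 * a - 2 * j%:R)).
  by apply: qerr_owns => //; [rewrite magnify_nil|move=> t t0; exact: lb].
have := E _ _ owns0; have := E _ _ owns1; have := E _ _ owns2.
suff -> : line u w l.+1 (size s) =
   (line u w l (size (own0 s)) + line u w l (size (own1 s)) + line u w l (size (own2 s))) / 75.
  lra.
rewrite /line -(size_own s) !natrD !exprS; field.
by rewrite expf_neq0.
Qed.

(** Each third with a deficit is charged to the side from which it is helped.
    The third on that side owns the helping centre, which sits at its border, so
    that it has a surplus of one deficit for every side it is charged from. *)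
Lemma line_first_step_unit P : triadic_cantor P -> s != [::] ->
  line (V1 + (V1 - V2)) (V1 - V2) 1 (size s) <= qerr P s.
Proof.
move=> hP s0; rewrite (qerr_thirds hP s0).
have s0' j : magnify j s != [::] by rewrite magnify_nil.
set q0 := qerr _ _; set q1 := qerr _ (magnify 1 s); set q2 := qerr _ (magnify 2 s).
pose lam : R := V1 - V2; pose u : R := V1 + lam.
have szE j o : size (magnify j o) = size o by exact: size_map.
pose e0 := q0 + (size (own0 s))%:R * lam - u.
pose e1 := q1 + (size (own1 s))%:R * lam - u.
pose e2 := q2 + (size (own2 s))%:R * lam - u.
suff : 0 <= e0 + e1 + e2.
  have V2E : V2 = V1 - lam :> R by rewrite /lam subKr.
  rewrite /e0 /e1 /e2 /line !expr1 -(size_own s) !natrD -/lam -/u; lra.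
have d0 : 0 < deficit :> R by rewrite /deficit /V1; lra.
(* The deficits; 8/25 and 18/25 are 8/5 in the coordinates of the first and
   of the middle third, 7/25 and 17/25 are -3/5 in those of the middle and
   of the last one. *)
have F0 : 0 <= e0 \/ - deficit <= e0 /\ exists2 a, a \in s & 3 / 10 <= a <= 8 / 25.
  have := qerr_deficit hP (s0' 0%N) owns0; rewrite szE -/q0 -/lam -/u /e0.
  move=> [?|[? [a []]]]; [left; lra|rewrite !mem_magnify mulr0 addr0 => sa _ ha].
  by right; split; [lra|exists (a / 5) => //; have := s_unit sa; lra].
have F1 : [\/ 0 <= e1,
    - deficit <= e1 /\ exists2 a, a \in s & 7 / 10 <= a <= 18 / 25 |
    - deficit <= e1 /\ exists2 a, a \in s & 7 / 25 <= a < 3 / 10].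
  have := qerr_deficit hP (s0' 1%N) owns1; rewrite szE -/q1 -/lam -/u /e1.
  move=> [?|[? [a []]]]; [by constructor 1; lra|rewrite !mem_magnify mem_filter mulr1].
  move=> sa; rewrite sa andbT negb_and -ltNge -leNgt => /orP ao ha.
  case: ha => ha; [constructor 2|constructor 3].
    by split; [lra|exists (a / 5 + 2 / 5) => //; lra].
  by split; [lra|exists (a / 5 + 2 / 5) => //; case: ao => ?; lra].
have F2 : 0 <= e2 \/ - deficit <= e2 /\ exists2 a, a \in s & 17 / 25 <= a < 7 / 10.
  have := qerr_deficit hP (s0' 2%N) owns2; rewrite szE -/q2 -/lam -/u /e2.
  move=> [?|[? [a []]]]; [by left; lra|rewrite !mem_magnify mem_filter].
  move=> sa; rewrite sa andbT -ltNge => ao ha; right.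
  split; [lra|exists (a / 5 + 2 / 5 * 2) => //; have := s_unit sa; lra].
have own_mem (j : nat) o a : a \in o -> 5 * a - 2 * j%:R \in magnify j o.
  by move=> oa; apply/mapP; exists a.
(* The surpluses of the thirds owning the centres just found. *)
have G0 a : a \in s -> 7 / 25 <= a < 3 / 10 -> deficit <= e0.
  move=> sa ha; have so : a \in own0 s by rewrite mem_filter sa andbT; lra.
  have := qerr_owner_right hP (s0' 0%N) owns0 (own_mem 0%N _ _ so).
  rewrite szE -/q0 -/lam -/u /e0 mulr0 subr0 => h; suff : 7 / 5 <= 5 * a by move=> /h; lra.
  lra.
have G1 a : a \in s -> 3 / 10 <= a <= 8 / 25 -> deficit <= e1.
  move=> sa ha; have so : a \in own1 s by rewrite mem_filter sa andbT; lra.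
  have := qerr_owner_left hP (s0' 1%N) owns1 (own_mem 1%N _ _ so).
  rewrite szE -/q1 -/lam -/u /e1 mulr1 => h; suff : 5 * a - 2 <= - (2 / 5) by move=> /h; lra.
  lra.
have G1' a : a \in s -> 17 / 25 <= a < 7 / 10 -> deficit <= e1.
  move=> sa ha; have so : a \in own1 s by rewrite mem_filter sa andbT; lra.
  have := qerr_owner_right hP (s0' 1%N) owns1 (own_mem 1%N _ _ so).
  rewrite szE -/q1 -/lam -/u /e1 mulr1 => h; suff : 7 / 5 <= 5 * a - 2 by move=> /h; lra.
  lra.
have G1'' a b : a \in s -> 3 / 10 <= a <= 8 / 25 -> b \in s -> 17 / 25 <= b < 7 / 10 ->
    2 * deficit <= e1.
  move=> sa ha sb hb; have so : a \in own1 s by rewrite mem_filter sa andbT; lra.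
  have so' : b \in own1 s by rewrite mem_filter sb andbT; lra.
  have h1 : 5 * a - 2 * 1%:R <= - (2 / 5) by rewrite mulr1; lra.
  have h2 : 7 / 5 <= 5 * b - 2 * 1%:R by rewrite mulr1; lra.
  have := qerr_owner_both hP (s0' 1%N) owns1 (own_mem 1%N _ _ so) h1 (own_mem 1%N _ _ so') h2.
  rewrite szE -/q1 -/lam -/u /e1; lra.
have G2 a : a \in s -> 7 / 10 <= a <= 18 / 25 -> deficit <= e2.
  move=> sa ha; have so : a \in own2 s by rewrite mem_filter sa andbT; lra.
  have := qerr_owner_left hP (s0' 2%N) owns2 (own_mem 2%N _ _ so).
  rewrite szE -/q2 -/lam -/u /e2 => h.
  suff : 5 * a - 2 * 2%:R <= - (2 / 5) by move=> /h; lra.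
  lra.
(* If the middle third has a deficit it has no surplus, hence it helps no
   neighbour and the outer thirds have no deficit. *)
have [E1|[E1 [c sc hc]]|[E1 [c sc hc]]] := F1.
- have [E0|[E0 [a sa ha]]] := F0; have [E2|[E2 [b sb hb]]] := F2.
  + lra.
  + have := G1' _ sb hb; lra.
  + have := G1 _ sa ha; lra.
  + have := G1'' _ _ sa ha sb hb; lra.
- have := G2 _ sc hc.
  have [E0|[E0 [a sa ha]]] := F0; last by have := G1 _ sa ha; lra.
  lra.
- have := G0 _ sc hc.
  have [E2|[E2 [b sb hb]]] := F2; last by have := G1' _ sb hb; lra.
  lra.
Qed.
End Unit.

Lemma lower_bound_first_step :
  lower_bound (line (V1 + (V1 - V2)) (V1 - V2) 1).
Proof.
move=> P hP s s0; apply: le_trans (qerr_clamp P s0).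
rewrite -(size_map clamp); apply: line_first_step_unit => //; last by case: (s) s0.
by move=> _ /mapP[a _ ->]; exact: clamp_unit.
Qed.

Lemma lower_bound_step u w l :
  line u w l 0 <= 1 / 4 ->
  (forall n, (0 < n)%N -> line u w l n <= (225^-1 + 4 / 25) / 3) ->
  lower_bound (line u w l) -> lower_bound (line u w l.+1).
Proof.
move=> l0 l1 lb P hP s s0; apply: le_trans (qerr_clamp P s0).
rewrite -(size_map clamp); apply: line_step_unit => //; last by case: (s) s0.
by move=> _ /mapP[a _ ->]; exact: clamp_unit.
Qed.

Let line_le u w l n : 0 <= w -> line u w l n <= line u w l 0.
Proof.
move=> w0; rewrite /line ler_pM2r ?invr_gt0 ?exprn_gt0 //.
by rewrite lerD2l lerN2 ler_wpM2r // ler_nat.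
Qed.

Let line0 u w l : line u w l 0 = u / 25 ^+ l.
Proof.
rewrite /line mul0r subr0 -[75](_ : 3 * 25 = 75 :> R); last by ring.
by rewrite exprMn; field; rewrite !expf_neq0.
Qed.

(** From level 1 on, the line at 0 is at most 1/100, so that [qerr_owns] applies
    to any numbers of own centres. *)
Let line_small u w l n : 0 <= u <= 1 / 4 -> 0 <= w -> (0 < l)%N ->
  line u w l n <= (225^-1 + 4 / 25) / 3.
Proof.
move=> /andP[u0 u1] w0; case: l => // l _.
apply: (le_trans (line_le _ _ _ w0)); rewrite line0 exprS invfM.
have p1 : (25 ^+ l)^-1 <= 1 :> R by rewrite invf_le1 ?exprn_gt0 // exprn_ege1 // ler1n.
have p0 : 0 <= (25 ^+ l)^-1 :> R by rewrite invr_ge0 exprn_ge0.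
move: (_^-1) p0 p1 => p p0 p1; nra.
Qed.

Lemma lower_bound_A l : lower_bound (line (V1 + (V1 - V2)) (V1 - V2) l).
Proof.
case: l => [|l]; first exact: lower_bound_base.
elim: l => [|l IH]; first exact: lower_bound_first_step.
have u01 : 0 <= (V1 : R) + (V1 - V2) <= 1 / 4 by rewrite /V1 /V2; lra.
have w0 : 0 <= V1 - V2 :> R by rewrite /V1 /V2; lra.
apply: lower_bound_step => // [|n _]; last exact: line_small.
by apply: le_trans (line_small _ u01 w0 _) _ => //; lra.
Qed.

(** At level 0 the only values that matter are those at 1, 2, 3 points; the third
    one is where the line A of level 1 equals V3. *)
Lemma lower_bound_B l : lower_bound (line (V2 + 2 * (V2 - V3)) (V2 - V3) l).
Proof.
elim: l => [|l IH].
  move=> P hP s s0; rewrite /line !expr0 mul1r divr1 /V2 /V3.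
  have := qerr_ge0 P s; have := lower_bound_A 1 hP s0; have := lower_bound_A 0 hP s0.
  rewrite /line !expr0 !expr1 mul1r divr1 /V1 /V2.
  have [|n4] := leqP (size s) 3.
    case: (size s) => [|[|[|[|//]]]] _; lra.
  have : 4 <= (size s)%:R :> R by rewrite ler_nat.
  lra.
have u01 : 0 <= (V2 : R) + 2 * (V2 - V3) <= 1 / 4 by rewrite /V2 /V3; lra.
have w0 : 0 <= V2 - V3 :> R by rewrite /V2 /V3; lra.
case: l IH => [|l] IH.
  apply: lower_bound_step => // [|n n0]; first by rewrite line0 expr0 divr1; lra.
  have : 1 <= n%:R :> R by rewrite ler1n.
  by rewrite /line !expr0 mul1r divr1 /V2 /V3; lra.
apply: lower_bound_step => // [|n _]; last exact: line_small.
by apply: le_trans (line_small _ u01 w0 _) _ => //; lra.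
Qed.

End LowerBounds.

(** * Cylinders, and the cost of a union of images *)

Section Words.
Variable R : realType.
Implicit Types (P : probability (measurableTypeR R) R) (s : seq R) (w : seq 'I_3) (f g : R -> R).

Lemma S_word_affine w (x : R) : S_word w x = 5^-1 ^+ size w * x + S_word w 0.
Proof.
elim: w x => [|j w IH] x /=; first by rewrite expr0 mul1r addr0.
by rewrite /simil IH exprS; ring.
Qed.

Lemma S_word_unit w (x : R) : 0 <= x <= 1 -> 0 <= S_word w x <= 1.
Proof. by elim: w x => //= j w IH x hx; apply: simil_unitI; exact: IH. Qed.

Lemma nice_S_word w f : nice f -> nice (fun x => f (S_word w x)).
Proof.
elim: w f => //= j w IH f nf.
exact: (IH (fun x => f (simil j x)) (nice_simil j nf)).
Qed.

Lemma big_tuple_cons l (F : seq 'I_3 -> R) :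
  \sum_(w : l.+1.-tuple 'I_3) F w = \sum_(j < 3) \sum_(w : l.-tuple 'I_3) F (j :: w).
Proof.
rewrite pair_bigA /= (reindex (fun p : 'I_3 * l.-tuple 'I_3 => cons_tuple p.1 p.2)) //=.
exists (fun w : l.+1.-tuple 'I_3 => (thead w, behead_tuple w)) => [[j w] _|w _].
  by congr pair; apply: val_inj.
by rewrite [in RHS](tuple_eta w).
Qed.

Lemma mean_words P l f : triadic_cantor P -> nice f ->
  mean P f = 3^-1 ^+ l * \sum_(w : l.-tuple 'I_3) mean P (fun x => f (S_word w x)).
Proof.
move=> hP; elim: l f => [|l IH] f nf.
  rewrite expr0 mul1r (big_pred1 [tuple]) // => w.
  by rewrite /= tuple0.
rewrite (big_tuple_cons _ (fun w => mean P (fun x => f (S_word w x)))) /=.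
rewrite (mean_self_similar hP nf) exprS -mulrA; congr (_ * _).
rewrite mulr_sumr; apply: eq_bigr => j _.
exact: (IH (fun x => f (simil j x)) (nice_simil j nf)).
Qed.

(** On the cylinder of w, only the images of beta w are used, and S_w divides
    squared distances by 25^l while the cylinder has mass 3^-l. *)
Lemma qerr_words_le P l (beta : l.-tuple 'I_3 -> seq R) s : triadic_cantor P ->
  (forall w : l.-tuple 'I_3, beta w != [::]) ->
  (forall (w : l.-tuple 'I_3) b, b \in beta w -> S_word w b \in s) ->
  qerr P s <= (\sum_w qerr P (beta w)) / 75 ^+ l.
Proof.
move=> hP b0 bs; rewrite /qerr (mean_words l hP); last exact: nice_sqdist.
have -> : (75 ^+ l)^-1 = 3^-1 ^+ l * 25^-1 ^+ l :> R.
  by rewrite -exprVn -exprMn; congr (_ ^+ l); field.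
rewrite [leRHS]mulrC -mulrA ler_pM2l ?exprn_gt0 ?invr_gt0 // mulr_sumr.
apply: ler_sum => w _; rewrite -meanZ; last exact: nice_sqdist.
apply: mean_le.
- by apply: nice_S_word; exact: nice_sqdist.
- by apply: niceM => //; exact: nice_sqdist.
move=> x hx; have [b bw ->] := sqdist_attained x (b0 w).
have -> : 25^-1 ^+ l * (x - b) ^+ 2 = (S_word w x - S_word w b) ^+ 2.
  rewrite (S_word_affine w x) (S_word_affine w b) size_tuple.
  have -> : 25^-1 = 5^-1 ^+ 2 :> R by field.
  by rewrite -exprM mulnC exprM; ring.
by apply: sqdist_le; exact: bs.
Qed.

End Words.

Section Distortion.
Variables (R : realType) (P : probability (measurableTypeR R) R).
Hypothesis hP : triadic_cantor P.

(** The minimum with neutral element +oo over the extended reals is the real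
    minimum as soon as there is a centre. *)
Lemma distortionE (alpha : {fset R}) : alpha != fset0 ->
  distortion P alpha = (qerr P alpha)%:E.
Proof.
move=> a0; have s0 : (alpha : seq R) != [::].
  apply: contra a0 => /eqP e; apply/eqP/fsetP => x; rewrite in_fset0.
  by apply/negbTE; rewrite -[x \in alpha]/(x \in (alpha : seq R)) e.
rewrite /qerr -ge0_meanE //; [|exact: nice_sqdist|by move=> x; exact: sqdist_ge0].
apply: eq_integral => x _; apply/eqP; rewrite eq_le; apply/andP; split.
  have [a sa ->] := sqdist_attained (x : R) s0.
  exact: bigmin_inf_seq sa _ _.
rewrite big_seq; elim/big_ind: _ => [|u v hu hv|a sa].
- by rewrite leey.
- by rewrite le_min hu.
- by rewrite lee_fin; exact: sqdist_le.
Qed.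

End Distortion.

Section Cylinders.
Variable R : realType.
Implicit Types (P : probability (measurableTypeR R) R) (w : seq 'I_3) (f g : R -> R).

(** Cylinder sets are intervals, which makes them measurable and lets linear
    arithmetic prove them disjoint. *)
Lemma JE w : J w = `[S_word w 0, S_word w 1]%classic :> set R.
Proof.
have [p p0 E] : exists2 p : R, 0 < p & forall x, S_word w x = p * x + S_word w 0.
  by exists (5^-1 ^+ size w); [rewrite exprn_gt0 // invr_gt0|exact: S_word_affine].
apply/seteqP; split => y /=; rewrite /J /= !in_itv /= [S_word w 1]E mulr1.
  by move=> [x]; rewrite in_itv /= => /andP[? ?] <-; rewrite (E x); apply/andP; split; nra.
move=> hy; exists ((y - S_word w 0) / p).
  by rewrite in_itv /= ler_pdivlMr // ler_pdivrMr //; lra.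
by rewrite (E (_ / _)); field; rewrite gt_eqF.
Qed.

Lemma JP w (x : R) : J w x <-> S_word w 0 <= x <= S_word w 1.
Proof. by rewrite JE /= in_itv. Qed.

Lemma measurable_J w : measurable (J w : set (measurableTypeR R)).
Proof. by rewrite JE; exact: measurable_itv. Qed.

Lemma J_unit w : J w `<=` unitI R.
Proof. by move=> _ [x] /unitIE hx <-; apply/unitIE; exact: S_word_unit. Qed.

Lemma nice_indic (B : set (measurableTypeR R)) : measurable B -> nice (\1_B : R -> R).
Proof.
move=> mB; split; first exact: measurable_indic.
by exists 1 => x _; rewrite indicE; case: (_ \in _); rewrite ?normr1 ?normr0.
Qed.

Lemma mean_indicU P g (A B : set (measurableTypeR R)) : measurable A -> measurable B ->
  (forall x, A x -> B x -> False) -> nice g ->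
  mean P (fun x => g x * \1_(A `|` B) x) =
  mean P (fun x => g x * \1_A x) + mean P (fun x => g x * \1_B x).
Proof.
move=> mA mB AB ng.
rewrite -meanD; [|by apply: niceM => //; exact: nice_indic..].
apply: eq_mean => x _; rewrite -mulrDr !indicE in_setU; congr (_ * _).
case: (boolP (x \in A)) => xA; case: (boolP (x \in B)) => xB /=; rewrite ?addr0 ?add0r //.
by case: (AB x); [exact: set_mem xA|exact: set_mem xB].
Qed.

Let simil_inj_letter (i j : 'I_3) (x y : R) : 0 <= x <= 1 -> 0 <= y <= 1 ->
  simil i x = simil j y -> i = j /\ x = y.
Proof.
move=> hx hy; rewrite /simil.
have [-> h|ne] := eqVneq i j; first by split => //; lra.
move: ne; case: i => -[|[|[|//]]] ? ; case: j => -[|[|[|//]]] ? //= _; lra.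
Qed.

(** A map S_i sends [0, 1] into the cylinder of j :: w only when i = j, so each
    letter of the word keeps one of the three terms of the self-similarity
    relation. *)
Lemma mean_J P w g : triadic_cantor P -> nice g ->
  mean P (fun x => g x * \1_(J w) x) = 3^-1 ^+ size w * mean P (fun x => g (S_word w x)).
Proof.
move=> hP; elim: w g => [|j w IH] g ng /=.
  rewrite expr0 mul1r; apply: eq_mean => x hx.
  rewrite indicE mem_set ?mulr1 //; apply/JP => /=; exact: hx.
have nJ : nice (fun x => g x * \1_(J (j :: w)) x).
  by apply: niceM => //; apply: nice_indic; exact: measurable_J.
rewrite (mean_self_similar hP nJ) (bigD1 j) //= big1 ?addr0 => [|i ij].
  rewrite exprS -mulrA -(IH (fun x => g (simil j x)) (nice_simil j ng)).
  congr (_ * _); apply: eq_mean => x hx; congr (_ * _); rewrite !indicE; congr (_ %:R).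
  congr nat_of_bool; apply/idP/idP => /set_mem h; apply/mem_set.
    case: h => y hy e; exists y => //; move: hy => /unitIE hy.
    by have [] := simil_inj_letter (S_word_unit w hy) hx e.
  by case: h => y hy <-; exists y.
transitivity (mean P (fun=> 0)); last exact: mean_cst.
apply: eq_mean => x hx; rewrite indicE memNset ?mulr0 // => -[y /unitIE hy e].
by have [/esym/eqP] := simil_inj_letter (S_word_unit w hy) hx e; rewrite (negbTE ij).
Qed.

Lemma mean_S_word P w : triadic_cantor P -> mean P (fun x => S_word w x) = S_word w 2^-1.
Proof.
move=> hP; transitivity (mean P (fun x => 5^-1 ^+ size w * x + S_word w 0)).
  by apply: eq_mean => x _; exact: S_word_affine.
by rewrite (mean_line hP) -S_word_affine.
Qed.

End Cylinders.

Section ConditionalMean.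
Variables (R : realType) (P : probability (measurableTypeR R) R).
Hypothesis hP : triadic_cantor P.
Variables (d : measure_display) (T : measurableType d) (Q : probability T R).
Variable X : {RV Q >-> measurableTypeR R}.
Hypothesis hX : forall A : set (measurableTypeR R), measurable A ->
  distribution Q X A = P A.

(** Both integrals over the probability space are integrals against the
    distribution of X, which agrees with P on measurable sets. *)
Lemma cond_meanE (B : set R) : measurable (B : set (measurableTypeR R)) ->
  B `<=` unitI R ->
  cond_mean Q X B = mean P (fun x => x * \1_B x) / mean P (fun x => 1 * \1_B x).
Proof.
move=> mB Bu; rewrite /cond_mean.
have mXB : measurable (X @^-1` B).
  by rewrite -[X in measurable X]setTI; apply: (measurable_funP X).
have E1 : (\int[Q]_(t in X @^-1` B) (X t)%:E = \int[P]_(x in B) x%:E)%E.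
  rewrite -(@integral_pushforward _ _ _ _ _ _ (measurable_funP X) _ _ EFin) //.
  - by apply: eq_measure_integral => A mA _; exact: hX.
  - apply: measurable_bounded_integrable => //.
    + by rewrite ltey_eq fin_num_measure.
    + have mX := measurable_funP X; exact: (mX (X @^-1` B)).
    + exists 1; split => // M M1 t /Bu /unitIE /andP[? ?] /=; rewrite ger0_norm //.
      by apply: ltW; apply: le_lt_trans M1.
have uB : B = unitI R `&` B by rewrite setIidr.
congr (_ / _).
  rewrite E1 /mean [in LHS]uB -/(Rintegral P _ id) Rintegral_mkcondr patch_indic.
  by [].
transitivity (fine (P B)); first by rewrite -hX.
rewrite /mean /Rintegral.
under eq_integral do rewrite mul1r.
by rewrite integral_indic ?setIidl //; exact: measurable_unitI.
Qed.

End ConditionalMean.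

(** * The centres of the theorem *)

Section Centres.
Variables (R : realType) (P : probability (measurableTypeR R) R).
Hypothesis hP : triadic_cantor P.
Variables (d : measure_display) (T : measurableType d) (Q : probability T R).
Variable X : {RV Q >-> measurableTypeR R}.
Hypothesis hX : forall A : set (measurableTypeR R), measurable A ->
  distribution Q X A = P A.

Lemma cond_mean_word w : cond_mean_words Q X [:: w] = S_word w 2^-1.
Proof.
rewrite /cond_mean_words big_seq1 (cond_meanE hX); last 2 first.
- exact: measurable_J.
- exact: J_unit.
rewrite (mean_J w hP (@nice_id R)) (mean_J w hP (nice_cst 1)) mean_S_word // mean_cst //.
by rewrite mulr1 mulrAC mulfV ?mul1r // expf_neq0.
Qed.

Let S1 : S_word [:: letter1] 2^-1 = 1 / 10 :> R.
Proof. by rewrite /= /simil /=; lra. Qed.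
Let S2 : S_word [:: letter2] 2^-1 = 1 / 2 :> R.
Proof. by rewrite /= /simil /=; lra. Qed.
Let S3 : S_word [:: letter3] 2^-1 = 9 / 10 :> R.
Proof. by rewrite /= /simil /=; lra. Qed.
Let S21 : S_word [:: letter2; letter1] 2^-1 = 21 / 50 :> R.
Proof. by rewrite /= /simil /=; lra. Qed.
Let S22 : S_word [:: letter2; letter2] 2^-1 = 1 / 2 :> R.
Proof. by rewrite /= /simil /=; lra. Qed.
Let S23 : S_word [:: letter2; letter3] 2^-1 = 29 / 50 :> R.
Proof. by rewrite /= /simil /=; lra. Qed.

Lemma alpha3E : alpha3 Q X = [fset 1 / 10; 1 / 2; 9 / 10]%fset.
Proof. by rewrite /alpha3 !cond_mean_word S1 S2 S3. Qed.

Let mean_word w : mean P (fun x => x * \1_(J w) x) = 3^-1 ^+ size w * S_word w 2^-1.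
Proof. by rewrite (mean_J w hP (@nice_id R)) mean_S_word. Qed.

Let prob_word w : mean P (fun x => 1 * \1_(J w) x) = 3^-1 ^+ size w.
Proof. by rewrite (mean_J w hP (nice_cst 1)) mean_cst // mulr1. Qed.

Lemma cond_mean_left :
  cond_mean_words Q X [:: [:: letter1]; [:: letter2; letter1]] = 9 / 50.
Proof.
have disj (x : R) : J [:: letter1] x -> J [:: letter2; letter1] x -> False.
  by rewrite !JP /= /simil /=; lra.
rewrite /cond_mean_words big_cons big_seq1 (cond_meanE hX); last 2 first.
- by apply: measurableU; exact: measurable_J.
- by move=> x []; exact: J_unit.
rewrite !mean_indicU //; try exact: measurable_J.
by rewrite !mean_word !prob_word S1 S21 /=; field.
Qed.

Lemma cond_mean_right :
  cond_mean_words Q X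
    [:: [:: letter2; letter2]; [:: letter2; letter3]; [:: letter3]] = 189 / 250.
Proof.
have disj (x : R) : J [:: letter2; letter3] x -> J [:: letter3] x -> False.
  by rewrite !JP /= /simil /=; lra.
have disj' (x : R) : J [:: letter2; letter2] x ->
    (J [:: letter2; letter3] `|` J [:: letter3]) x -> False.
  by move=> h [] h'; move: h h'; rewrite !JP /= /simil /=; lra.
have mU : measurable (J [:: letter2; letter3] `|` J [:: letter3] : set (measurableTypeR R)).
  by apply: measurableU; exact: measurable_J.
rewrite /cond_mean_words !big_cons big_nil setU0 (cond_meanE hX); last 2 first.
- by apply: measurableU => //; exact: measurable_J.
- by move=> x [|[]]; exact: J_unit.
rewrite !mean_indicU //; try exact: measurable_J.
by rewrite !mean_word !prob_word S22 S23 S3 /=; field.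
Qed.

Lemma alpha2E : alpha2 Q X = [fset 9 / 50; 189 / 250]%fset.
Proof. by rewrite /alpha2 cond_mean_left cond_mean_right. Qed.

Lemma nice_integral f : nice f -> (\int[P]_x (f x)%:E = (mean P f)%:E)%E.
Proof.
move=> nf; have [mf _] := nf.
have mN : measurable (~` unitI R) by apply: measurableC; exact: measurable_unitI.
have TN : [set: measurableTypeR R] `\` ~` unitI R = unitI R by rewrite setTD setCK.
rewrite (negligible_integral mN) //; last 2 first.
- apply/(negligible_integrable mN) => //; first exact/measurable_EFinP.
    exact: null_compl_unitI.
  by rewrite TN; exact: nice_integrable.
- exact: null_compl_unitI.
rewrite TN /mean /Rintegral fineK //.
by apply: integrable_fin_num; [exact: measurable_unitI|exact: nice_integrable].
Qed.

Lemma ge0_integral_X f : nice f -> (forall x, 0 <= f x) ->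
  (\int[Q]_t (f (X t))%:E = (mean P f)%:E)%E.
Proof.
move=> nf f0; rewrite -(ge0_meanE hP nf f0).
transitivity (\int[distribution Q X]_y (EFin \o f) y)%E; last first.
  by apply: eq_measure_integral => A mA _; exact: hX.
rewrite ge0_integral_distribution //.
by apply/measurable_EFinP; case: nf.
Qed.

Lemma expectation_X : ('E_Q[X] = (2^-1)%:E)%E.
Proof.
rewrite unlock -(mean_id hP) -nice_integral //.
transitivity (\int[distribution Q X]_y (EFin \o id) y)%E; last first.
  by apply: eq_measure_integral => A mA _; exact: hX.
rewrite integral_distribution //.
  by apply/measurable_EFinP; exact: measurable_id.
apply/integrableP; split.
  by apply/measurable_EFinP; have mX := measurable_funP X; exact: mX.
rewrite (_ : (fun x => _) = fun t => (`|X t|)%:E) //.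
rewrite (@ge0_integral_X (fun x => `|x|)) ?ltry //.
exact: nice_norm.
Qed.

Lemma variance_X : ('V_Q[X] = V1%:E)%E.
Proof.
rewrite /variance unlock expectation_X unlock /=.
transitivity (\int[Q]_t ((X t - 2^-1) ^+ 2)%:E)%E.
  by apply: eq_integral => t _.
rewrite (@ge0_integral_X (fun x => (x - 2^-1) ^+ 2)).
- by rewrite mean_sqr_dist // subrr expr0n addr0.
- by apply: niceX; apply: niceD.
- by move=> x; exact: sqr_ge0.
Qed.

Lemma mean_sqdist_affine_le s u v b : b \in s -> u != 0 ->
  mean P (fun x => sqdist s (u * x + v)) <= u ^+ 2 / 9 + (u / 2 + v - b) ^+ 2.
Proof.
move=> sb u0; rewrite -addrA -(mean_sqr_affine hP); apply: mean_le.
- by apply: nice_sqdist_affine => //; case: (s) sb.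
- by apply: niceX; apply: niceD => //; exact: niceM.
- by move=> x _; rewrite addrA; exact: sqdist_le.
Qed.

(** The middle third is cut once more: its first ninth goes to the left centre,
    the two others to the right one. *)
Lemma qerr_pair_le : qerr P [:: 9 / 50; 189 / 250] <= V2.
Proof.
set s := [:: _; _].
have sL : 9 / 50 \in s by rewrite mem_head.
have sR : 189 / 250 \in s by rewrite inE mem_head orbT.
have nf u v : u != 0 -> nice (fun x => sqdist s (u * x + v)).
  by move=> u0; exact: nice_sqdist_affine.
have B (f : R -> R) u v b : u != 0 -> (forall x, f x = u * x + v) -> b \in s ->
    mean P (fun x => sqdist s (f x)) <= u ^+ 2 / 9 + (u / 2 + v - b) ^+ 2.
  move=> u0 fE sb; rewrite (@eq_mean _ _ _ (fun x => sqdist s (u * x + v))); last first.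
    by move=> x _; rewrite fE.
  exact: mean_sqdist_affine_le.
rewrite /qerr (mean_thirds hP); last exact: nice_sqdist.
rewrite [mean P (fun x => _ (x / 5 + 2 / 5))](mean_thirds hP); last first.
  rewrite (_ : (fun x => _) = fun x => sqdist s (5^-1 * x + 2 / 5)); last first.
    by apply/funext => x; rewrite mulrC.
  by apply: nf; rewrite invr_eq0.
have n5 : 5^-1 != 0 :> R by rewrite invr_eq0.
have n25 : 25^-1 != 0 :> R by rewrite invr_eq0.
have b0 : mean P (fun x => sqdist s (x / 5)) <= 5^-1 ^+ 2 / 9 + (5^-1 / 2 + 0 - 9 / 50) ^+ 2.
  by apply: B => // x; field.
have b2 : mean P (fun x => sqdist s (x / 5 + 4 / 5)) <=
    5^-1 ^+ 2 / 9 + (5^-1 / 2 + 4 / 5 - 189 / 250) ^+ 2.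
  by apply: B => // x; field.
have b10 : mean P (fun x => sqdist s (x / 5 / 5 + 2 / 5)) <=
    25^-1 ^+ 2 / 9 + (25^-1 / 2 + 2 / 5 - 9 / 50) ^+ 2.
  by apply: B => // x; field.
have b11 : mean P (fun x => sqdist s ((x / 5 + 2 / 5) / 5 + 2 / 5)) <=
    25^-1 ^+ 2 / 9 + (25^-1 / 2 + 12 / 25 - 189 / 250) ^+ 2.
  by apply: B => // x; field.
have b12 : mean P (fun x => sqdist s ((x / 5 + 4 / 5) / 5 + 2 / 5)) <=
    25^-1 ^+ 2 / 9 + (25^-1 / 2 + 14 / 25 - 189 / 250) ^+ 2.
  by apply: B => // x; field.
rewrite /V2; lra.
Qed.

Lemma qerr_pairE : qerr P [:: 9 / 50; 189 / 250] = V2.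
Proof.
apply/eqP; rewrite eq_le qerr_pair_le /= /V2.
exact: qerr_ge2.
Qed.

Lemma qerr_singleE : qerr P [:: 2^-1] = V1.
Proof.
apply/eqP; rewrite eq_le qerr_ge1 // andbT.
rewrite -[V1]addr0 -[X in _ + X](_ : (2^-1 - 2^-1) ^+ 2 = 0); last by rewrite subrr expr0n.
rewrite -(mean_sqr_dist hP); apply: mean_le.
- exact: nice_sqdist.
- by apply: niceX; apply: niceD.
- by move=> x _; apply: sqdist_le; rewrite mem_head.
Qed.

Lemma qerr_tripleE : qerr P [:: 1 / 10; 1 / 2; 9 / 10] = V3.
Proof.
apply/eqP; rewrite eq_le; apply/andP; split; last first.
  have := @lower_bound_A R 1 P hP [:: 1 / 10; 1 / 2; 9 / 10] isT.
  by rewrite /line /V1 /V2 /V3 expr1 /=; lra.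
apply: (le_trans (@qerr_words_le _ P 1 (fun=> [:: 2^-1]) _ hP _ _)) => //.
  move=> w b; rewrite inE => /eqP ->; case/tupleP: w => j w; rewrite tuple0 /=.
  rewrite !inE /simil; case: j => -[|[|[|//]]] /= ?; apply/or3P.
  - by constructor 1; apply/eqP; field.
  - by constructor 2; apply/eqP; field.
  - by constructor 3; apply/eqP; field.
rewrite sumr_const card_tuple card_ord qerr_singleE /V1 /V3 expr1; lra.
Qed.

End Centres.

(** * Optimality *)

Section Optimality.
Variables (R : realType) (P : probability (measurableTypeR R) R).
Hypothesis hP : triadic_cantor P.

Lemma card_bigfcup_le (K : finType) (F : K -> {fset R}) (I : {set K}) (m : nat) :
  (forall i, #|` F i| <= m)%N -> (#|` \bigcup_(i in I) F i|%fset <= #|I| * m)%N.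
Proof.
move=> hF; rewrite -sum_nat_const.
elim/big_rec2: _ => [|i k A _ IH]; first by rewrite cardfs0.
by apply: leq_trans (leq_card_fsetU _ _).1 _; exact: leq_add.
Qed.

Lemma card_imset_tuple_le (K : finType) (f : K -> R) (I : {set K}) :
  (#|` [fset f w | w in I]%fset| <= #|I|)%N.
Proof.
apply: leq_trans (leq_imfset_card _ _ _) _.
by rewrite cardE.
Qed.

Lemma optimal_of_bounds n (alpha : {fset R}) (c : R) :
  (1 <= #|` alpha| <= n)%N -> qerr P alpha <= c ->
  (forall s : seq R, s != [::] -> (size s <= n)%N -> c <= qerr P s) ->
  [/\ optimal_means P n alpha, quantization_error P n = distortion P alpha &
      distortion P alpha = c%:E].
Proof.
move=> cn up lo.
have nil0 (A : {fset R}) : (1 <= #|` A|)%N -> (A : seq R) != [::] /\ A != fset0.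
  by move=> A1; split; [case: (A : seq R) A1|rewrite -cardfs_gt0].
have [a0 a0'] := nil0 alpha (andP cn).1.
have De : distortion P alpha = c%:E.
  rewrite distortionE //; congr (_%:E); apply/eqP; rewrite eq_le up lo //.
  by case/andP: cn.
have Qe : quantization_error P n = distortion P alpha.
  apply/eqP; rewrite eq_le; apply/andP; split.
    by apply: ereal_inf_lbound; exists alpha.
  apply: le_ereal_inf_tmp => _ [A /= /andP[A1 An] <-].
  have [b0 b0'] := nil0 A A1.
  by rewrite De distortionE // lee_fin; exact: lo.
by split.
Qed.

Lemma sum_word_cases l (I : {set l.-tuple 'I_3}) (a b : R) :
  \sum_(w : l.-tuple 'I_3) (if w \in I then a else b) =
  #|I|%:R * a + ((3 ^ l)%:R - #|I|%:R) * b.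
Proof.
rewrite (bigID (mem I)) /=; congr (_ + _).
  by rewrite (eq_bigr (fun=> a)) => [|w ->] //; rewrite sumr_const mulr_natl.
rewrite (eq_bigr (fun=> b)) => [|w /negbTE ->] //.
rewrite sumr_const -[LHS]mulr_natl; congr (_ * b).
have := cardC (mem I); rewrite card_tuple card_ord => <-.
by rewrite natrD addrC addKr.
Qed.

Lemma eq_mem_qerr s t : s != [::] -> s =i t -> qerr P s = qerr P t.
Proof.
move=> s0 st; have t0 : t != [::].
  by apply: contra s0 => /eqP e; case: (s) st => // a s' /(_ a); rewrite e mem_head.
apply/eqP; rewrite eq_le; apply/andP; split; apply: le_qerr => // x _ a.
  by rewrite -st => sa; exists a.
by rewrite st => ta; exists a.
Qed.

Lemma line_card_le u w l n (s : seq R) : 0 <= w -> (size s <= n)%N ->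
  s != [::] -> lower_bound (line u w l) -> line u w l n <= qerr P s.
Proof.
move=> w0 sn s0 lb; apply: le_trans (lb P hP s s0).
rewrite /line ler_pM2r ?invr_gt0 ?exprn_gt0 //.
by rewrite lerD2l lerN2 ler_wpM2r // ler_nat.
Qed.

End Optimality.

Theorem theorem3p7 (R : realType)
    (P : probability (measurableTypeR R) R) (hP : triadic_cantor P)
    (d : measure_display) (T : measurableType d) (Q : probability T R)
    (X : {RV Q >-> measurableTypeR R})
    (hX : forall A : set (measurableTypeR R), measurable A ->
            distribution Q X A = P A)
    (n l : nat) (hn : (3 <= n)%N) (hl : (3 ^ l <= n < 3 ^ l.+1)%N)
    (I : {set l.-tuple 'I_3})
    (hI : #|I| = (if n <= 2 * 3 ^ l then n - 3 ^ l else n - 2 * 3 ^ l)%N) :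
  [/\ optimal_means P n (alpha_n Q X n I),
      quantization_error P n = distortion P (alpha_n Q X n I) &
      distortion P (alpha_n Q X n I) =
        (if (n <= 2 * 3 ^ l)%N then
           (75 ^- l)%:E *
             (((2 * 3 ^ l)%:R - n%:R)%:E * 'V_Q[X] +
              (n%:R - (3 ^ l)%:R)%:E * distortion P (alpha2 Q X))
         else
           (75 ^- l)%:E *
             (((3 ^ l.+1)%:R - n%:R)%:E * distortion P (alpha2 Q X) +
              (n%:R - (2 * 3 ^ l)%:R)%:E * distortion P (alpha3 Q X)))%E].
Proof.
have /andP[hl1 hl2] := hl.
have w1 : 0 <= V1 - V2 :> R by rewrite /V1 /V2; lra.
have w2 : 0 <= V2 - V3 :> R by rewrite /V2 /V3; lra.
rewrite (alpha2E hP hX) (alpha3E hP hX) (variance_X hP hX).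
have E2 : distortion P [fset 9 / 50; 189 / 250]%fset = V2%:E.
  rewrite distortionE // -?cardfs_gt0 ?cardfs2 // -(qerr_pairE hP); congr (_%:E).
  by apply/esym/eq_mem_qerr => // x; rewrite !inE.
have E3 : distortion P [fset 1 / 10; 1 / 2; 9 / 10]%fset = V3%:E.
  rewrite distortionE //; last by apply/fset0Pn; exists (1 / 10); rewrite !inE eqxx.
  rewrite -(qerr_tripleE hP); congr (_%:E).
  by apply/esym/eq_mem_qerr => // x; rewrite !inE orbA.
rewrite E2 E3 -!EFinM.
have cardC : (#|~: I| + #|I| = 3 ^ l)%N.
  by rewrite addnC cardsC card_tuple card_ord.
rewrite /alpha_n (alpha2E hP hX) (alpha3E hP hX).
set A2 := [fset _; _]%fset; set A3 := [fset _; _; _]%fset.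
have cA2 : (#|` A2| <= 2)%N by rewrite cardfs2; case: (_ != _).
have cA3 : (#|` A3| <= 3)%N.
  by apply: leq_trans (leq_card_fsetU _ _).1 _; rewrite cardfs1 addn1 ltnS cardfs2; case: (_ != _).
have cS (A : {fset R}) (w : l.-tuple 'I_3) :
    (#|` [fset S_word w x | x in A]%fset| <= #|` A|)%N.
  exact: leq_imfset_card.
have nonempty (A : {fset R}) (beta : l.-tuple 'I_3 -> seq R) :
    (forall w, beta w != [::]) ->
    (forall (w : l.-tuple 'I_3) b, b \in beta w -> S_word w b \in (A : seq R)) -> (1 <= #|` A|)%N.
  move=> b0 bA; rewrite cardfs_gt0; apply/fset0Pn.
  have := b0 (nseq_tuple l ord0); case E: (beta _) => [//|b t] _.
  by exists (S_word (nseq_tuple l ord0) b); apply: bA; rewrite E mem_head.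
case: leqP hI => hn2 hI.
- set alpha := (_ `|` _)%fset.
  pose beta (w : l.-tuple 'I_3) : seq R := if w \in I then [:: 9 / 50; 189 / 250] else [:: 2^-1].
  have beta0 w : beta w != [::] by rewrite /beta; case: ifP.
  have sub (w : l.-tuple 'I_3) b : b \in beta w -> S_word w b \in (alpha : seq R).
    rewrite /beta; case: ifP => wI bw; apply/fsetUP.
      right; apply/bigfcupP; exists w; first by rewrite mem_index_enum wI.
      by apply/imfsetP; exists b; rewrite // !inE in bw *.
    left; apply/imfsetP; exists w; first by rewrite !inE wI.
    by move: bw; rewrite inE => /eqP ->; rewrite (cond_mean_word hP hX).
  apply: optimal_of_bounds => //.
  + apply/andP; split; first by apply: (nonempty _ beta) => // w; exact: beta0.
    apply: leq_trans (leq_card_fsetU _ _).1 _.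
    apply: (leq_trans (leq_add (card_imset_tuple_le _ _) (card_bigfcup_le _ (m := 2) _))).
      by move=> w; apply: leq_trans (cS _ _) cA2.
    by rewrite muln2 -addnn addnA cardC hI subnKC.
  + apply: le_trans (@qerr_words_le _ P l beta _ hP beta0 sub) _.
    rewrite (eq_bigr (fun w : l.-tuple 'I_3 => if w \in I then V2 else V1)); last first.
      by move=> w _; rewrite /beta; case: ifP => _; rewrite ?qerr_pairE ?qerr_singleE.
    rewrite sum_word_cases hI mulrC ler_pM2l ?invr_gt0 ?exprn_gt0 //.
    rewrite natrB // natrM; lra.
  + move=> s s0 sn; have := line_card_le hP w1 sn s0 (@lower_bound_A R l).
    apply: le_trans; rewrite /line [leRHS]mulrC ler_pM2l ?invr_gt0 ?exprn_gt0 //.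
    rewrite natrM -natrX; lra.
- set alpha := (_ `|` _)%fset.
  pose beta (w : l.-tuple 'I_3) : seq R :=
    if w \in I then [:: 1 / 10; 1 / 2; 9 / 10] else [:: 9 / 50; 189 / 250].
  have beta0 w : beta w != [::] by rewrite /beta; case: ifP.
  have sub (w : l.-tuple 'I_3) b : b \in beta w -> S_word w b \in (alpha : seq R).
    rewrite /beta; case: ifP => wI bw; apply/fsetUP; [right|left].
      apply/bigfcupP; exists w; first by rewrite mem_index_enum wI.
      by apply/imfsetP; exists b; rewrite // !inE -?orbA in bw *.
    apply/bigfcupP; exists w; first by rewrite mem_index_enum inE wI.
    by apply/imfsetP; exists b; rewrite // !inE in bw *.
  apply: optimal_of_bounds => //.
  + apply/andP; split; first by apply: (nonempty _ beta) => // w; exact: beta0.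
    apply: leq_trans (leq_card_fsetU _ _).1 _.
    apply: (leq_trans (leq_add (card_bigfcup_le _ (m := 2) _) (card_bigfcup_le _ (m := 3) _))).
    - by move=> w; apply: leq_trans (cS _ _) cA2.
    - by move=> w; apply: leq_trans (cS _ _) cA3.
    by rewrite [(#|I| * 3)%N]mulnS addnCA -mulnDl cardC mulnC hI subnK // ltnW.
  + apply: le_trans (@qerr_words_le _ P l beta _ hP beta0 sub) _.
    rewrite (eq_bigr (fun w : l.-tuple 'I_3 => if w \in I then V3 else V2)); last first.
      by move=> w _; rewrite /beta; case: ifP => _; rewrite ?qerr_pairE ?qerr_tripleE.
    rewrite sum_word_cases hI mulrC ler_pM2l ?invr_gt0 ?exprn_gt0 //.
    rewrite natrB ?(ltnW hn2) // expnS !natrM; lra.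
  + move=> s s0 sn; have := line_card_le hP w2 sn s0 (@lower_bound_B R l).
    apply: le_trans; rewrite /line [leRHS]mulrC ler_pM2l ?invr_gt0 ?exprn_gt0 //.
    rewrite expnS !natrM -natrX; lra.
Qed.
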